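(* Let $n\ge2k$, $\mathbf A_k\in\{\mathbf{TL}_k(n),\mathbf M_k(n),\mathbf{PR}_k\}$, $\lambda=[n-m,m]\in\Lambda^{\mathbf A_k}_n$, and let $r,s\ge0$ with $r+2s=k$ (for $\mathbf{TL}_k(n)$) or $r+s=k$ (otherwise). Then $\chi^\lambda_{\mathbf A_k}(\mathbf 1_r\otimes e^{\otimes s})=\mathsf F^{m,r}_{\mathbf A_k}$, where (a) $\mathsf F^{m,r}_{\mathbf{TL}_k(n)}=\binom{r}{\frac{r-m}{2}}-\binom{r}{\frac{r-m}{2}-1}$; (b) $\mathsf F^{m,r}_{\mathbf M_k(n)}=\sum_{t\ge0}\binom{r}{m+2t}\left(\binom{m+2t}{t}-\binom{m+2t}{t-1}\right)$; (c) $\mathsf F^{m,r}_{\mathbf{PR}_k}=\binom{r}{m}$.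
   Context: $\mathcal P_k$: set partitions of $\{1,\dots,k,1',\dots,k'\}$ (blocks), top row $1..k$, bottom row $1'..k'$; $\mathbf P_k(n)$ has basis $\mathcal P_k$ and product $d_1d_2=n^{\ell(d_1,d_2)}d_1\circ d_2$ (concatenation discarding $\ell$ components lying in the middle). Planar = drawable without crossings inside the rectangle of vertices. $\mathbf{TL}_k(n)$, $\mathbf M_k(n)$, $\mathbf{PR}_k$ are spanned by the planar diagrams all of whose blocks have size 2; size 1 or 2; resp. at most one vertex in each row. $\Lambda^{\mathbf A_k}_n=\{[n-m,m]:0\le m\le k\}$ for $\mathbf M_k,\mathbf{PR}_k$, and with $m\equiv k\bmod 2$ for $\mathbf{TL}_k$. The irreducible module $\mathbf A^\lambda_k$ has basis the symmetric $m$-diagrams in the algebra (a symmetric $m$-diagram is given by a set partition of $\{1..k\}$ with $m$ distinguished blocks $B$, and has blocks $B\cup B'$ for these and $B,B'$ otherwise), with action $d\cdot w=n^{\ell(d,w)}d\circ w\circ d^T$ if this has $m$ propagating blocks, else $0$ ($d^T$ = reflection); $\chi^\lambda_{\mathbf A_k}$ is its character. $\mathbf 1_r$ is the identity diagram in $\mathcal P_r$; $\otimes$ juxtaposes diagrams; $e=\frac1n\mathfrak e_1$ (blocks $\{1,2\},\{1',2'\}$) for $\mathbf{TL}_k$ and $e=\frac1n\mathfrak p_1$ (blocks $\{1\},\{1'\}$) otherwise. Binomial coefficients with negative or too large lower index are $0$. *)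

(* Defs.v *)
From HB Require Import structures.
From mathcomp Require Import all_boot all_order all_algebra.
Set Implicit Arguments. Unset Strict Implicit. Unset Printing Implicit Defensive.
Import Order.TTheory GRing.Theory Num.Theory.

(* Partition diagrams.  Vertices of a k-diagram: inl i = top vertex i+1,
   inr i = bottom vertex (i+1)'.  A diagram is a set of blocks
   (a set partition of the 2k vertices, checked by [partition d setT]). *)
Definition V (k : nat) : finType := ('I_k + 'I_k)%type.
Definition diagram (k : nat) := {set {set V k}}.

Definition is_diagram k (d : diagram k) := partition d [set: V k].

Definition swapV k (v : V k) : V k :=
  match v with inl i => inr i | inr i => inl i end.
Definition transp k (d : diagram k) : diagram k := [set (@swapV k) @: B | B : {set V k} in d].

(* Concatenation d1 o d2: bottom row of d1 glued to top row of d2.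
   Stacked vertex set: level 0 = top of d1, 1 = middle, 2 = bottom of d2. *)
Definition W (k : nat) : finType := ('I_3 * 'I_k)%type.
Definition lev0 : 'I_3 := @Ordinal 3 0 isT.
Definition lev1 : 'I_3 := @Ordinal 3 1 isT.
Definition lev2 : 'I_3 := @Ordinal 3 2 isT.
Definition emb1 k (v : V k) : W k :=
  match v with inl i => (lev0, i) | inr i => (lev1, i) end.
Definition emb2 k (v : V k) : W k :=
  match v with inl i => (lev1, i) | inr i => (lev2, i) end.
Definition embO k (v : V k) : W k :=
  match v with inl i => (lev0, i) | inr i => (lev2, i) end.
Definition stackrel k (d1 d2 : diagram k) : rel (W k) :=
  fun x y =>
    [exists B : {set V k} in d1, (x \in (@emb1 k) @: B) && (y \in (@emb1 k) @: B)] ||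
    [exists B : {set V k} in d2, (x \in (@emb2 k) @: B) && (y \in (@emb2 k) @: B)].

Definition compose k (d1 d2 : diagram k) : diagram k :=
  [set [set v | connect (stackrel d1 d2) (@embO k u) (@embO k v)] | u : V k].

Definition ell k (d1 d2 : diagram k) : nat :=
  #|[set [set y | connect (stackrel d1 d2) x y] |
      x in [set x : W k | (x.1 == lev1) &&
             [forall y, connect (stackrel d1 d2) x y ==> (y.1 == lev1)]]]|.

Definition nprop k (d : diagram k) : nat :=
  #|[set B in d | [exists i, inl i \in B] && [exists j, inr j \in B]]|.

Definition liftL a b (v : V a) : V (a + b) :=
  match v with inl i => inl (lshift b i) | inr i => inr (lshift b i) end.
Definition liftR a b (v : V b) : V (a + b) :=
  match v with inl i => inl (rshift a i) | inr i => inr (rshift a i) end.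
Definition tensor a b (d1 : diagram a) (d2 : diagram b) : diagram (a + b) :=
  [set (@liftL a b) @: B | B : {set V a} in d1] :|: [set (@liftR a b) @: B | B : {set V b} in d2].

Definition castV a b (E : a = b) (v : V a) : V b :=
  match v with inl i => inl (cast_ord E i) | inr i => inr (cast_ord E i) end.
Definition castD a b (E : a = b) (d : diagram a) : diagram b :=
  [set (@castV a b E) @: B | B : {set V a} in d].

Definition idD r : diagram r := [set [set (inl i : V r); inr i] | i : 'I_r].
Definition frakE : diagram 2 :=
  [set [set (inl ord0 : V 2); inl ord_max]; [set (inr ord0 : V 2); inr ord_max]].
Definition frakP : diagram 1 := [set [set (inl ord0 : V 1)]; [set (inr ord0 : V 1)]].
Definition emptyD : diagram 0 := set0.

(* Planarity: the partition is non-crossing w.r.t. the cyclic boundary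
   order 1,...,k,k',...,1' of the rectangle. *)
Definition pos k (v : V k) : nat :=
  match v with inl i => val i | inr i => (2 * k).-1 - val i end.
Definition planar k (d : diagram k) : bool :=
  [forall B in d, forall C in d, (B != C) ==>
     ~~ [exists a in B, exists c in B, exists b in C, exists e in C,
          (pos a < pos b) && (pos b < pos c) && (pos c < pos e)]].

Inductive Alg := TL | Motz | PRook.

Definition blockcond (A : Alg) k (d : diagram k) : bool :=
  match A with
  | TL => [forall B in d, #|B| == 2]
  | Motz => [forall B in d, (#|B| == 1) || (#|B| == 2)]
  | PRook => [forall B in d, (#|[set i | (inl i : V k) \in B]| <= 1) &&
                             (#|[set j | (inr j : V k) \in B]| <= 1)]
  end.

Definition inAlg (A : Alg) k (d : diagram k) : bool :=
  [&& is_diagram d, planar d & blockcond A d].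

(* Lambda^{A_k}_n = {[n-m,m] : 0 <= m <= k} (with m = k mod 2 for TL);
   the weight [n-m,m] is recorded by m. *)
Definition inLambda (A : Alg) (k m : nat) : bool :=
  (m <= k) && (if A is TL then odd m == odd k else true).

Definition topB k (B : {set 'I_k}) : {set V k} := [set (inl i : V k) | i in B].
Definition botB k (B : {set 'I_k}) : {set V k} := [set (inr i : V k) | i in B].
Definition symm_mdiag k (m : nat) (d : diagram k) : bool :=
  [exists Q : {set {set 'I_k}}, exists D : {set {set 'I_k}},
    [&& partition Q [set: 'I_k], D \subset Q, #|D| == m &
      d == [set topB B :|: botB B | B in D] :|:
           [set topB B | B in Q :\: D] :|: [set botB B | B in Q :\: D]]].

Definition modBasis (A : Alg) k m : {set diagram k} :=
  [set w : diagram k | symm_mdiag m w && inAlg A w].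

(* Trace of the action of a diagram d on A_k^lambda:
   d . w = n^{l(d,w)} d o w o d^T if this has m propagating blocks, else 0. *)
Definition trD (n : nat) (A : Alg) k m (d : diagram k) : rat :=
  \sum_(w in modBasis A k m)
    ((n%:R : rat) ^+ ell d w *
     ((compose (compose d w) (transp d) == w) &&
      (nprop (compose (compose d w) (transp d)) == m))%:R)%R.

(* Elements of the algebra as formal linear combinations of diagrams. *)
Definition element k := seq (rat * diagram k).
Definition chi (n : nat) (A : Alg) k m (x : element k) : rat :=
  (\sum_(p <- x) p.1 * trD n A m p.2)%R.

Definition tensorE a b (x : element a) (y : element b) : element (a + b) :=
  [seq ((p.1 * q.1)%R, tensor p.2 q.2) | p <- x, q <- y].
Definition castE a b (E : a = b) (x : element a) : element b :=
  [seq (p.1, castD E p.2) | p <- x].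
Definition idE r : element r := [:: (1%R, idD r)].

Definition cA (A : Alg) : nat := if A is TL then 2 else 1.
Definition genE (n : nat) (A : Alg) : element (cA A) :=
  match A return element (cA A) with
  | TL => [:: (((n%:R : rat)^-1)%R, frakE)]
  | Motz => [:: (((n%:R : rat)^-1)%R, frakP)]
  | PRook => [:: (((n%:R : rat)^-1)%R, frakP)]
  end.

Fixpoint powE c (x : element c) (s : nat) : element (s * c) :=
  match s return element (s * c) with
  | 0 => [:: (1%R, emptyD)]
  | s'.+1 => castE (esym (mulSnr s' c)) (tensorE (powE x s') x)
  end.

Definition binZ (r : nat) (j : int) : int :=
  if (j < 0)%R then 0%R else Posz 'C(r, `|j|%N).

Definition Fval (A : Alg) (m r : nat) : int :=
  match A with
  | TL => let j := ((Posz r - Posz m)%R %/ 2)%Z in (binZ r j - binZ r (j - 1))%R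
  | Motz => (\sum_(t < r.+1)
               binZ r (Posz (m + 2 * t)) *
               (binZ (m + 2 * t) (Posz t) - binZ (m + 2 * t) (Posz t - 1)))%R
  | PRook => Posz 'C(r, m)
  end.

(* Main.v *)
Require Import Defs.
From mathcomp Require Import all_boot all_order all_algebra all_fingroup.
From mathcomp Require Import zify.
Set Implicit Arguments. Unset Strict Implicit. Unset Printing Implicit Defensive.
Import GRing.Theory Num.Theory.

(** The diagram [1_r (x) e^(x)s] has [r] vertical strands followed by [s] caps (for
    TL) or isolated points in each row.  The top blocks of a diagram [d] survive in
    [d o w o d^T], so this product can equal [w] only if [w] contains them;
    conversely a symmetric [w] containing them is fixed, and exactly [s] components
    are discarded.  The factor [n^s] cancels [(1/n)^s], so the character counts the
    noncrossing half-diagrams with [m] defects on the first [r] points.  Removing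
    the last point, which is a defect, isolated, or the right end of an arc whose
    left end then becomes a defect, gives the recursion of the lattice paths
    ending at height [m], which the three formulas satisfy as well. *)

(** * Counting lattice paths *)

Definition allows_singletons (A : Alg) : bool := if A is TL then false else true.
Definition allows_arcs (A : Alg) : bool := if A is PRook then false else true.

Fixpoint path_count (A : Alg) (r m : nat) : nat :=
  if r is r'.+1 then
    (if m is m'.+1 then path_count A r' m' else 0)
    + allows_singletons A * path_count A r' m + allows_arcs A * path_count A r' m.+1
  else m == 0.

Lemma path_count_small A r m : r < m -> path_count A r m = 0.
Proof.
by elim: r m => [|r IH] [|m] //= lt_rm; rewrite !IH //; lia.
Qed.

Lemma path_count_TL_odd r m : odd (r + m) -> path_count TL r m = 0.
Proof.
elim: r m => [|r IH] [|m] odd_rm //; rewrite /= mul0n !IH //; lia.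
Qed.

Definition ballot (r t : nat) : int := (binZ r t - binZ r (Posz t - 1))%R.

Lemma ballot0 r : ballot r 0 = 1%R.
Proof. by rewrite /ballot /binZ /= bin0. Qed.

Lemma ballotSE r t : ballot r t.+1 = (Posz 'C(r, t.+1) - Posz 'C(r, t))%R.
Proof. by rewrite /ballot (_ : Posz t.+1 - 1 = t)%R //; lia. Qed.

Lemma ballotS r t : ballot r.+1 t.+1 = (ballot r t.+1 + ballot r t)%R.
Proof.
by case: t => [|t]; rewrite ?ballot0 !ballotSE !binS ?bin0; lia.
Qed.

Lemma ballot_mid t : ballot (2 * t).+1 t.+1 = 0%R.
Proof.
rewrite ballotSE -[X in (Posz X - _)%R]bin_sub; last by lia.
by rewrite (_ : (2 * t).+1 - t.+1 = t) ?subrr //; lia.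
Qed.

Lemma path_count_TL t m : Posz (path_count TL (m + 2 * t) m) = ballot (m + 2 * t) t.
Proof.
move def_r: (m + 2 * t) => r.
elim: r m t def_r => [|r IH] m t def_r.
  by have [-> ->] : m = 0 /\ t = 0 by lia.
rewrite /= mul0n addn0 mul1n.
case: t def_r => [|t] def_r.
  rewrite (@path_count_small TL r m.+1) ?ballot0 //; last by lia.
  by case: m def_r => [|m] def_r //; rewrite addn0 (IH m 0) ?ballot0 //; lia.
case: m def_r => [|m] def_r; rewrite ballotS.
  rewrite add0n (IH 1 t) //; last by lia.
  by rewrite (_ : r = (2 * t).+1) ?ballot_mid ?add0r //; lia.
by rewrite PoszD (IH m t.+1) ?(IH m.+2 t) //; lia.
Qed.

Lemma path_count_PRook r m : path_count PRook r m = 'C(r, m).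
Proof.
elim: r m => [|r IH] [|m] //=; rewrite !IH mul1n mul0n addn0 ?bin0 //.
by rewrite binS addnC.
Qed.

Lemma sum_binS r (f : nat -> nat) :
  \sum_(j < r.+2) 'C(r.+1, j) * f j = \sum_(j < r.+1) 'C(r, j) * (f j + f j.+1).
Proof.
under [RHS]eq_bigr do rewrite mulnDr.
rewrite big_split [LHS]big_ord_recl bin0.
under [in LHS]eq_bigr do rewrite lift0 binS mulnDl.
rewrite big_split addnA /=; congr (_ + _).
transitivity (\sum_(j < r.+2) 'C(r, j) * f j); first by rewrite [RHS]big_ord_recl bin0.
by rewrite big_ord_recr /= bin_small ?addn0.
Qed.

(* The sum is over the number of points that are not singletons. *)
Lemma path_count_Motz r m :
  path_count Motz r m = \sum_(j < r.+1) 'C(r, j) * path_count TL j m.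
Proof.
elim: r m => [|r IH] m; first by rewrite big_ord1 mul1n.
rewrite (sum_binS r (path_count TL ^~ m)) /= !mul1n -addnA addnCA.
under [RHS]eq_bigr do rewrite mul0n addn0 mul1n mulnDr.
rewrite big_split /= {1}IH; congr (_ + _).
under [RHS]eq_bigr do rewrite mulnDr.
rewrite big_split /= -IH; congr (_ + _).
case: m => [|m] /=; last by rewrite IH.
by rewrite big1 // => j _; rewrite muln0.
Qed.

Lemma sum_same_parity m N (f : nat -> nat) :
  (forall j, j < m -> f j = 0) -> (forall j, odd (j + m) -> f j = 0) ->
  \sum_(j < m + 2 * N) f j = \sum_(t < N) f (m + 2 * t).
Proof.
move=> f_small f_odd; elim: N => [|N IH].
  by rewrite muln0 addn0 big_ord0 big1 // => j _; apply: f_small.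
rewrite mulnS addnCA !big_ord_recr /= IH (f_odd (m + 2 * N).+1) ?addn0 //.
by lia.
Qed.

Lemma path_count_Fval A r m : (A = TL -> odd m = odd r) ->
  Posz (path_count A r m) = Fval A m r.
Proof.
case: A => [/(_ erefl) odd_mr|_|_] /=; last by rewrite path_count_PRook.
  have [lt_rm|le_mr] := ltnP r m.
    rewrite path_count_small // /binZ !ifT //; lia.
  have [t ->] : exists t, r = m + 2 * t by exists (r - m)./2; lia.
  rewrite path_count_TL /ballot.
  by rewrite (_ : (Posz (m + 2 * t) - Posz m)%R = (Posz t * 2)%R) ?mulzK //; lia.
rewrite path_count_Motz; pose F j := 'C(r, j) * path_count TL j m.
have le_r : r.+1 <= m + 2 * r.+1 by lia.
rewrite (big_ord_widen _ F le_r) big_rmcond => [|j]; last first.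
  by rewrite -leqNgt /F => /bin_small->.
rewrite sum_same_parity => [|j|j]; rewrite /F.
- rewrite (big_morph Posz PoszD erefl).
  by apply: eq_bigr => t _; rewrite PoszM path_count_TL.
- by move=> /path_count_small->; rewrite muln0.
- by move=> /path_count_TL_odd->; rewrite muln0.
Qed.

(** * Set partitions and transpositions *)

Lemma trivIset_mem_eq (X : finType) (P : {set {set X}}) B C :
  trivIset P -> B \in P -> C \in P -> {in C &, forall x y, (x \in B) = (y \in B)}.
Proof.
move=> tP BP CP x y xC yC; apply/idP/idP => inB.
  by rewrite -(def_pblock tP BP inB) (def_pblock tP CP xC).
by rewrite -(def_pblock tP BP inB) (def_pblock tP CP yC).
Qed.

Lemma partitionU (X : finType) (P Q : {set {set X}}) (A B : {set X}) :
  partition P A -> partition Q B -> [disjoint A & B] ->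
  partition (P :|: Q) (A :|: B).
Proof.
move=> /and3P[/eqP covP tP P0] /and3P[/eqP covQ tQ Q0] dAB; apply/and3P; split.
- by rewrite /cover bigcup_setU -/(cover P) -/(cover Q) covP covQ.
- by apply: trivIsetU => //; rewrite covP covQ.
- by rewrite inE negb_or P0.
Qed.

Lemma partition_set1 (X : finType) (D : {set X}) : partition (set1 @: D) D.
Proof.
have [x y _ _ neq_xy|x _|part1 _] := @indexed_partition _ _ D (@set1 X).
- by rewrite disjoints1 inE eq_sym.
- by apply/set0Pn; exists x; rewrite inE.
rewrite -[X in partition _ X](_ : cover (set1 @: D) = D) //.
apply/setP => x; apply/bigcupP/idP => [[_ /imsetP[y yD ->] /set1P->]|xD] //.
by exists [set x]; rewrite ?imset_f ?set11.
Qed.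

Lemma imset_set1_cover (X : finType) (P : {set {set X}}) :
  {in P, forall B : {set X}, #|B| = 1} -> set1 @: cover P = P.
Proof.
move=> single; apply/esym/setP => B; apply/idP/imsetP => [BP|[x /bigcupP[C CP xC] ->]].
  have /eqP/cards1P[x Bx] := single B BP; exists x => //.
  by apply/bigcupP; exists B; rewrite // Bx set11.
have /eqP/cards1P[y Cy] := single C CP.
by move: xC CP; rewrite Cy => /set1P->.
Qed.

Lemma partitionD (X : finType) (P Q : {set {set X}}) (D : {set X}) :
  partition Q D -> P \subset Q -> partition (Q :\: P) (D :\: cover P).
Proof.
move=> /and3P[/eqP covQ tQ Q0] /subsetP sPQ; apply/and3P; split.
- apply/eqP/setP => x; rewrite inE -covQ; apply/bigcupP/andP.
    case=> B /setDP[BQ nBP] xB; split; last by apply/bigcupP; exists B.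
    apply: contra nBP => /bigcupP[C CP xC].
    by rewrite -(def_pblock tQ BQ xB) (def_pblock tQ (sPQ _ CP) xC).
  case=> xP /bigcupP[B BQ xB]; exists B; rewrite // inE BQ andbT.
  by apply: contra xP => BP; apply/bigcupP; exists B.
- exact: trivIsetD.
- by rewrite inE (negPf Q0) andbF.
Qed.

Lemma lshift_rshift_setT a b : lshift b @: [set: 'I_a] :|: @rshift a b @: setT = setT.
Proof.
apply/setP => i; rewrite !inE; case: (split_ordP i) => j ->; by rewrite imset_f ?orbT.
Qed.

Lemma lshift_rshift_disjoint a b (D1 : {set 'I_a}) (D2 : {set 'I_b}) :
  [disjoint lshift b @: D1 & @rshift a b @: D2].
Proof.
apply/pred0Pn => -[i /= /andP[/imsetP[j1 _ ->] /imsetP[j2 _]]].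
by move/eqP; rewrite eq_lrshift.
Qed.

Lemma card_in_can2 (X Y : finType) (S : {set X}) (S' : {set Y}) f g :
  {in S, forall x, f x \in S'} -> {in S', forall y, g y \in S} ->
  {in S, cancel f g} -> {in S', cancel g f} -> #|S| = #|S'|.
Proof.
move=> fS gS fK gK; apply/eqP; rewrite eqn_leq; apply/andP; split.
  rewrite -(card_in_imset (can_in_inj fK)); apply/subset_leq_card/subsetP.
  by move=> _ /imsetP[x xS ->]; apply: fS.
rewrite -(card_in_imset (can_in_inj gK)); apply/subset_leq_card/subsetP.
by move=> _ /imsetP[y yS ->]; apply: gS.
Qed.

Lemma mul_tperm_invol (X : finType) (p : {perm X}) x y :
  involutive p -> tperm (p x) (p y) = tperm x y -> involutive (p * tperm x y)%g.
Proof.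
by move=> pK tpE z; rewrite !permM (inj_tperm _ _ _ (@perm_inj _ p)) tpE pK tpermK.
Qed.

Lemma mul_tperm_imageE (X : finType) (p : {perm X}) x y :
  involutive p -> (p * tperm x (p x))%g y = if (y == x) || (y == p x) then y else p y.
Proof.
move=> pK; rewrite permM; have [->|ne_yx] := eqVneq y x; first by rewrite tpermR.
have [->|ne_ypx] := eqVneq y (p x); first by rewrite pK tpermL.
rewrite tpermD //; last by rewrite (inj_eq perm_inj) eq_sym.
by apply: contraNneq ne_ypx => ->; rewrite pK.
Qed.

Lemma mul_tperm_fixedE (X : finType) (p : {perm X}) x y z : p x = x -> p y = y ->
  (p * tperm x y)%g z = if z == x then y else if z == y then x else p z.
Proof.
move=> px py; rewrite permM; have [->|ne_zx] := eqVneq z x; first by rewrite px tpermL.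
have [->|ne_zy] := eqVneq z y; first by rewrite py tpermR.
have ne_fixed u : p u = u -> z != u -> u != p z.
  by move=> {2}<-; rewrite (inj_eq perm_inj) eq_sym.
by rewrite tpermD // ne_fixed.
Qed.

(** * Symmetric diagrams *)

Definition strand k (i : 'I_k) : {set V k} := [set inl i; inr i].

Definition sym_diagram k (D : {set 'I_k}) (T : {set {set 'I_k}}) : diagram k :=
  @strand k @: D :|: @topB k @: T :|: @botB k @: T.

Lemma in_topB k (B : {set 'I_k}) v :
  (v \in topB B) = if v is inl i then i \in B else false.
Proof.
case: v => i; first by rewrite /topB mem_imset // => ? ? [].
by apply/imsetP => -[].
Qed.

Lemma in_botB k (B : {set 'I_k}) v :
  (v \in botB B) = if v is inr i then i \in B else false.
Proof.
case: v => i; last by rewrite /botB mem_imset // => ? ? [].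
by apply/imsetP => -[].
Qed.

Lemma in_strand k (i : 'I_k) v :
  (v \in strand i) = match v with inl j | inr j => j == i end.
Proof. by case: v => j; rewrite !inE /eq_op /= ?orbF. Qed.

Definition in_blockE := (in_topB, in_botB, in_strand).

Lemma topB_inj k : injective (@topB k).
Proof. by apply: imset_inj => ? ? []. Qed.

Lemma strand_inj k : injective (@strand k).
Proof. by move=> i j /setP/(_ (inl i)); rewrite !in_strand eqxx => /esym/eqP. Qed.

Lemma topB_botB_set1 k (i : 'I_k) : topB [set i] :|: botB [set i] = strand i.
Proof. by rewrite /topB /botB !imset_set1. Qed.

Section SymDiagram.

Variables (k : nat) (D : {set 'I_k}) (T : {set {set 'I_k}}).

Lemma sym_diagramP B :
  reflect [\/ exists2 i, i \in D & B = strand i,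
              exists2 C, C \in T & B = topB C | exists2 C, C \in T & B = botB C]
          (B \in sym_diagram D T).
Proof.
apply: (iffP idP) => [/setUP[/setUP[]|]/imsetP h|[] /imsetP h];
  rewrite ?in_setU ?h ?orbT //; by [apply: Or31|apply: Or32|apply: Or33].
Qed.

Lemma strand_sym_diagram i : i \in D -> strand i \in sym_diagram D T.
Proof. by move=> iD; apply/sym_diagramP; apply: Or31; exists i. Qed.

Lemma topB_sym_diagram C : C \in T -> topB C \in sym_diagram D T.
Proof. by move=> CT; apply/sym_diagramP; apply: Or32; exists C. Qed.

Lemma botB_sym_diagram C : C \in T -> botB C \in sym_diagram D T.
Proof. by move=> CT; apply/sym_diagramP; apply: Or33; exists C. Qed.

Lemma mem_strand_sym_diagram i : (strand i \in sym_diagram D T) = (i \in D).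
Proof.
apply/idP/idP => [/sym_diagramP[[j jD /strand_inj->]|[C _]|[C _]]|] //.
- by move/setP/(_ (inr i)); rewrite !in_blockE eqxx.
- by move/setP/(_ (inl i)); rewrite !in_blockE eqxx.
- exact: strand_sym_diagram.
Qed.

Lemma mem_topB_sym_diagram C : C != set0 -> (topB C \in sym_diagram D T) = (C \in T).
Proof.
move=> /set0Pn[i iC].
apply/sym_diagramP/idP => [[[j _]|[B BT /topB_inj->]|[B _]]|CT] //.
- by move/setP/(_ (inr j)); rewrite !in_blockE eqxx.
- by move/setP/(_ (inl i)); rewrite !in_blockE iC.
- by apply: Or32; exists C.
Qed.

Lemma nprop_sym_diagram : nprop (sym_diagram D T) = #|D|.
Proof.
rewrite -(card_imset D (@strand_inj k)); apply: eq_card => B.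
rewrite inE; apply/andP/imsetP => [[/sym_diagramP[][c cT ->]]|[i iD ->]].
- by exists c.
- by case/andP=> _ /existsP[j]; rewrite in_topB.
- by case/andP=> /existsP[j]; rewrite in_botB.
- split; first exact: strand_sym_diagram.
  by apply/andP; split; apply/existsP; exists i; rewrite in_strand.
Qed.

Hypothesis partT : partition T (~: D).

Lemma sym_diagram_partition : is_diagram (sym_diagram D T).
Proof.
pose S : {set V k} := [set v | match v with inl i | inr i => i \in D end].
have strands_part : partition (@strand k @: D) S.
  have [i j _ _ neq_ij||partS _] := @indexed_partition _ _ D (@strand k).
  - apply/pred0Pn => -[v /=]; rewrite !in_strand.
    by case: v => l /andP[/eqP-> eq_ij]; rewrite eq_sym eq_ij in neq_ij.
  - by move=> i _; apply/set0Pn; exists (inl i); rewrite in_strand.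
  rewrite (_ : S = cover (@strand k @: D)) //; apply/setP => v.
  rewrite cover_imset inE; apply/idP/bigcupP => [|[i iD]]; rewrite ?in_strand.
    by case: v => i iD; exists i; rewrite ?in_strand.
  by case: v => j /eqP->.
have top_part : partition (@topB k @: T) (topB (~: D)).
  by rewrite (imset_partition _ _ inl_inj).
have bot_part : partition (@botB k @: T) (botB (~: D)).
  by rewrite (imset_partition _ _ inr_inj).
rewrite /is_diagram (_ : [set: V k] = S :|: topB (~: D) :|: botB (~: D)); last first.
  by apply/setP => -[] i; rewrite !(inE, in_blockE) ?orbF ?orbN.
have disjoint_notin (A B : {set V k}) :
    (forall v, v \in A -> v \notin B) -> [disjoint A & B].
  by move=> AB; apply/pred0Pn => -[v /= /andP[/AB/negP]].
apply: partitionU bot_part _; first apply: partitionU strands_part top_part _;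
  apply: disjoint_notin => -[] i.
all: by rewrite !(inE, in_blockE) ?negbK ?orbF.
Qed.

End SymDiagram.

Lemma sym_diagram_inj k (D D' : {set 'I_k}) (T T' : {set {set 'I_k}}) :
  set0 \notin T -> set0 \notin T' ->
  sym_diagram D T = sym_diagram D' T' -> D = D' /\ T = T'.
Proof.
move=> T0 T'0 eqd; split.
  by apply/setP => i; rewrite -(mem_strand_sym_diagram D T) eqd mem_strand_sym_diagram.
apply/setP => C; have [->|C0] := eqVneq C set0; first by rewrite (negPf T0) (negPf T'0).
by rewrite -(mem_topB_sym_diagram D T C0) eqd mem_topB_sym_diagram.
Qed.

(** * Concatenation *)

Section Stack.

Variables (k : nat) (d1 d2 : diagram k).
Local Notation joined := (connect (stackrel d1 d2)).

Definition joined_in_block (d : diagram k) (emb : V k -> W k) (x y : W k) : Prop :=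
  exists2 B, B \in d & exists u v, [/\ u \in B, v \in B, x = emb u & y = emb v].

Lemma joined_in_blockP d (emb : V k -> W k) x y :
  reflect (joined_in_block d emb x y)
          [exists B : {set V k} in d, (x \in emb @: B) && (y \in emb @: B)].
Proof.
apply: (iffP exists_inP) => [[B Bd /andP[/imsetP[u uB ->] /imsetP[v vB ->]]]|].
  by exists B => //; exists u, v.
by case=> B Bd [u [v [uB vB -> ->]]]; exists B; rewrite // !imset_f.
Qed.

Lemma stackrelP x y :
  reflect (joined_in_block d1 (@emb1 k) x y \/ joined_in_block d2 (@emb2 k) x y)
          (stackrel d1 d2 x y).
Proof. by apply: (iffP orP) => -[] /joined_in_blockP; auto. Qed.

Lemma joined_emb1 B u v : B \in d1 -> u \in B -> v \in B -> joined (emb1 u) (emb1 v).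
Proof.
by move=> Bd uB vB; apply/connect1/stackrelP; left; exists B => //; exists u, v.
Qed.

Lemma joined_emb2 B u v : B \in d2 -> u \in B -> v \in B -> joined (emb2 u) (emb2 v).
Proof.
by move=> Bd uB vB; apply/connect1/stackrelP; right; exists B => //; exists u, v.
Qed.

Lemma stackrel_closed (a : {pred W k}) :
  {in d1, forall B : {set V k},
    {in B &, forall u v, (emb1 u \in a) = (emb1 v \in a)}} ->
  {in d2, forall B : {set V k},
    {in B &, forall u v, (emb2 u \in a) = (emb2 v \in a)}} ->
  closed (stackrel d1 d2) a.
Proof.
move=> closed1 closed2 x y /stackrelP[] [B Bd [u [v [uB vB -> ->]]]].
  exact: closed1 Bd _ _ uB vB.
exact: closed2 Bd _ _ uB vB.
Qed.

Lemma joined_sym : connect_sym (stackrel d1 d2).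
Proof.
apply: sym_connect_sym => x y; rewrite /stackrel.
by congr orb; apply: eq_existsb => B; rewrite [in RHS]andbC andbA andbAC -andbA andbC.
Qed.

Lemma composeE :
  compose d1 d2 =
  equivalence_partition (fun u v => joined (embO u) (embO v)) [set: V k].
Proof.
rewrite /compose /equivalence_partition.
have classE u : [set v | joined (embO u) (embO v)] =
    [set v in [set: V k] | joined (embO u) (embO v)] by apply/setP => v; rewrite !inE.
by apply/setP => B; apply/imsetP/imsetP => -[u _ ->]; exists u.
Qed.

Lemma compose_partition : is_diagram (compose d1 d2).
Proof.
rewrite composeE; apply: equivalence_partitionP => x y z _ _ _.
by split=> [|/(same_connect joined_sym)->]; first exact: connect0.
Qed.

Lemma compose_eq (w : diagram k) : is_diagram w ->
  (forall u v, joined (embO u) (embO v) = (v \in pblock w u)) -> compose d1 d2 = w.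
Proof.
move=> partw joinedE; rewrite composeE -[RHS](equivalence_partition_pblock partw).
by apply: eq_imset => u; apply/setP => v; rewrite !inE joinedE.
Qed.

(* A top block of the upper diagram is not glued to anything below it. *)
Lemma compose_topB C : is_diagram d1 -> topB C \in d1 -> topB C \in compose d1 d2.
Proof.
move=> part1 Cd; have t1 := partition_trivIset part1.
have /set0Pn[[i|i] iC] := partition_neq0 part1 Cd; rewrite in_topB // in iC.
apply/imsetP; exists (inl i) => //; apply/setP => v; rewrite inE; apply/idP/idP.
  rewrite in_topB; case: v => // j jC.
  by apply: (joined_emb1 (u := inl i) (v := inl j) Cd); rewrite in_topB.
pose top_comp : {pred W k} := [pred x | (x.1 == lev0) && (x.2 \in C)].
have emb1E u : (emb1 u \in top_comp) = (u \in topB C) by rewrite in_topB; case: u.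
have emb2E u : (emb2 u \in top_comp) = false by case: u.
have embOE u : (embO u \in top_comp) = (u \in topB C) by rewrite in_topB; case: u.
have comp_closed : closed (stackrel d1 d2) top_comp.
  apply: stackrel_closed => B Bd x y xB yB; rewrite ?emb1E ?emb2E //.
  exact: (trivIset_mem_eq t1 Cd Bd).
by move=> /(closed_connect comp_closed); rewrite !embOE in_topB iC => <-.
Qed.

End Stack.

Section Absorption.

Variables (k : nat) (D : {set 'I_k}) (T : {set {set 'I_k}}) (w : diagram k).
Hypotheses (partT : partition T (~: D)) (partw : is_diagram w).
Hypothesis topw : {in T, forall C, topB C \in w}.

Let tw : trivIset w := partition_trivIset partw.
Local Notation joined := (connect (stackrel (sym_diagram D T) w)).

Lemma joined_embO_emb2 B u :
  B \in w -> u \in B -> B \notin @topB k @: T -> joined (embO u) (emb2 u).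
Proof.
case: u => i Bw iB topB'; last exact: connect0.
have [iD|] := boolP (i \in D).
  have strand_d := strand_sym_diagram T iD.
  by apply: (@joined_emb1 _ _ w _ (inl i) (inr i) strand_d); rewrite in_strand.
rewrite -in_setC -(cover_partition partT) => /bigcupP[C CT iC].
case/imsetP: topB'; exists C => //.
by rewrite -(def_pblock tw Bw iB) (def_pblock tw (topw CT)) ?in_topB.
Qed.

Lemma compose_absorb : compose (sym_diagram D T) w = w.
Proof.
apply: compose_eq => // u v; set B := pblock w u.
have uw : u \in cover w by rewrite (cover_partition partw) inE.
have [Bw uB] : B \in w /\ u \in B by rewrite pblock_mem ?mem_pblock.
apply/idP/idP => [|vB].
  pose low (x : W k) : V k := if x.1 == lev2 then inr x.2 else inl x.2.
  have [lowO low2] : cancel (@embO k) low /\ cancel (@emb2 k) low by split=> -[].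
  have B_closed : closed (stackrel (sym_diagram D T) w) [pred x | low x \in B].
    apply: stackrel_closed => E Ed x y xE yE; rewrite !inE ?low2; last first.
      exact: (trivIset_mem_eq tw Bw Ed).
    case/sym_diagramP: Ed xE yE => [[i _ ->]|[C CT ->]|[C CT ->]]; rewrite !in_blockE.
    - by case: x y => i' [] j /eqP-> /eqP->.
    - case: x y => i [] j //= iC jC.
      by apply: (trivIset_mem_eq tw Bw (topw CT)); rewrite in_topB.
    - case: x y => i [] j //= iC jC.
      by apply: (trivIset_mem_eq tw Bw (topw CT)); rewrite in_topB.
  by move/(closed_connect B_closed); rewrite !inE !lowO uB => <-.
have [/imsetP[C CT BE]|topB'] := boolP (B \in @topB k @: T).
  move: uB vB; rewrite BE !in_topB; case: u {B uw Bw BE} v => i [] j // iC jC.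
  have top_d := topB_sym_diagram D CT.
  by apply: (@joined_emb1 _ _ w _ (inl i) (inl j) top_d); rewrite in_topB.
apply: connect_trans (joined_embO_emb2 Bw uB topB') _.
rewrite joined_sym; apply: connect_trans (joined_embO_emb2 Bw vB topB') _.
exact: joined_emb2 Bw vB uB.
Qed.

Definition middle_block (C : {set 'I_k}) : {set W k} := [set (lev1, i) | i in C].

Lemma in_middle_block C x : (x \in middle_block C) = (x.1 == lev1) && (x.2 \in C).
Proof.
case: x => l i; apply/imsetP/andP => [[j jC [-> ->]]|[/eqP/=-> iC]] //.
by exists i.
Qed.

(* Neither the bottom blocks of the upper diagram nor [w] link a block of [T]
   to another point. *)
Lemma middle_component C i : C \in T -> i \in C ->
  [set y | joined (lev1, i) y] = middle_block C.
Proof.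
move=> CT iC; apply/setP => x; rewrite inE.
apply/idP/imsetP => [|[j jC ->]]; last first.
  by apply: (@joined_emb2 _ _ w _ (inl i) (inl j) (topw CT)); rewrite in_topB.
have emb1E u : (emb1 u \in middle_block C) = (u \in botB C).
  by rewrite in_middle_block in_botB; case: u.
have emb2E u : (emb2 u \in middle_block C) = (u \in topB C).
  by rewrite in_middle_block in_topB; case: u.
have mid_closed : closed (stackrel (sym_diagram D T) w) (middle_block C).
  have td := partition_trivIset (sym_diagram_partition partT).
  apply: stackrel_closed => B Bd u v uB vB; rewrite ?emb1E ?emb2E.
    exact: (trivIset_mem_eq td (botB_sym_diagram D CT) Bd).
  exact: (trivIset_mem_eq tw (topw CT) Bd).
move/(closed_connect mid_closed); rewrite !in_middle_block /= iC.
by case: x => l j /esym/andP[/eqP/=-> jC]; exists j.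
Qed.

Lemma ell_absorb : ell (sym_diagram D T) w = #|T|.
Proof.
have middle_inj : injective middle_block by apply: imset_inj => i j [].
rewrite -(card_imset _ middle_inj); apply: eq_card => X.
apply/imsetP/imsetP => [[[l i]]|[C CT ->]].
  rewrite inE /= => /andP[/eqP-> /forallP only_middle] ->.
  have : i \in ~: D.
    rewrite inE; apply/negP => /(strand_sym_diagram T) strand_d.
    have := only_middle (lev0, i).
    by rewrite (@joined_emb1 _ _ w _ (inr i) (inl i) strand_d) ?in_strand.
  rewrite -(cover_partition partT) => /bigcupP[C CT iC].
  by exists C; rewrite ?(middle_component CT iC).
have /set0Pn[i iC] := partition_neq0 partT CT.
have componentE := middle_component CT iC.
exists (lev1, i); last by rewrite componentE.
rewrite inE /=; apply/forallP => y; apply/implyP => joined_y.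
have : y \in middle_block C by rewrite -componentE inE.
by rewrite in_middle_block => /andP[].
Qed.

End Absorption.

Section Transpose.

Variable k : nat.
Implicit Types d : diagram k.

Lemma swapVK : involutive (@swapV k). Proof. by case. Qed.

Lemma imset_swapVK : involutive (fun B : {set V k} => @swapV k @: B).
Proof.
move=> B /=; rewrite -imset_comp -[RHS]imset_id.
by apply: eq_imset => v /=; rewrite swapVK.
Qed.

Lemma transpK : involutive (@transp k).
Proof.
move=> d; rewrite /transp -imset_comp -[RHS]imset_id.
by apply: eq_imset => B /=; rewrite imset_swapVK.
Qed.

Lemma swapV_strand (i : 'I_k) : @swapV k @: strand i = strand i.
Proof. by rewrite /strand imsetU !imset_set1 setUC. Qed.

Lemma swapV_topB (C : {set 'I_k}) : @swapV k @: topB C = botB C.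
Proof. by rewrite /topB -imset_comp. Qed.

Lemma swapV_botB (C : {set 'I_k}) : @swapV k @: botB C = topB C.
Proof. by rewrite -swapV_topB imset_swapVK. Qed.

Lemma transp_sym_diagram (D : {set 'I_k}) T :
  transp (sym_diagram D T) = sym_diagram D T.
Proof.
rewrite /transp /sym_diagram !imsetU -!imset_comp setUAC.
congr (_ :|: _ :|: _); apply: eq_imset => C /=.
- exact: swapV_strand.
- exact: swapV_botB.
- exact: swapV_topB.
Qed.

Definition flipW (x : W k) : W k := (rev_ord x.1, x.2).

Lemma flipWK : involutive flipW.
Proof. by case=> l i; rewrite /flipW /= rev_ordK. Qed.

Lemma flipW_emb1 v : flipW (emb1 v) = emb2 (swapV v).
Proof. by case: v => i; congr (_, _); apply: val_inj. Qed.

Lemma flipW_emb2 v : flipW (emb2 v) = emb1 (swapV v).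
Proof. by case: v => i; congr (_, _); apply: val_inj. Qed.

Lemma flipW_embO v : flipW (embO v) = embO (swapV v).
Proof. by case: v => i; congr (_, _); apply: val_inj. Qed.

Lemma stackrel_transp d1 d2 x y :
  stackrel d1 d2 x y -> stackrel (transp d2) (transp d1) (flipW x) (flipW y).
Proof.
case/stackrelP=> -[B Bd [u [v [uB vB -> ->]]]]; apply/stackrelP; [right | left].
  exists (@swapV k @: B); first exact: imset_f.
  by exists (swapV u), (swapV v); rewrite !flipW_emb1 !imset_f.
exists (@swapV k @: B); first exact: imset_f.
by exists (swapV u), (swapV v); rewrite !flipW_emb2 !imset_f.
Qed.

Lemma joined_transp d1 d2 x y :
  connect (stackrel (transp d2) (transp d1)) (flipW x) (flipW y) =
  connect (stackrel d1 d2) x y.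
Proof.
have homo (e1 e2 : diagram k) z t : connect (stackrel e1 e2) z t ->
    connect (stackrel (transp e2) (transp e1)) (flipW z) (flipW t).
  case/connectP=> p path_p ->; apply/connectP; exists (map flipW p).
    by apply: homo_path path_p; apply: stackrel_transp.
  by rewrite last_map.
by apply/idP/idP => /homo //; rewrite !transpK !flipWK.
Qed.

Lemma transp_compose d1 d2 : transp (compose d1 d2) = compose (transp d2) (transp d1).
Proof.
rewrite /transp -/(transp d1) -/(transp d2) /compose -imset_comp.
have classE u : @swapV k @: [set v | connect (stackrel d1 d2) (embO u) (embO v)] =
    [set v | connect (stackrel (transp d2) (transp d1)) (embO (swapV u)) (embO v)].
  apply/setP => v; rewrite -[v]swapVK mem_imset; last exact: inv_inj swapVK.
  by rewrite !inE -joined_transp !flipW_embO.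
apply/setP => B; apply/imsetP/imsetP => -[u _ ->]; exists (swapV u) => //.
  by rewrite /= classE.
by rewrite /= classE swapVK.
Qed.

End Transpose.

Lemma sym_diagram_fixed k (H D : {set 'I_k}) U T :
  partition U (~: H) -> partition T (~: D) ->
  (compose (compose (sym_diagram H U) (sym_diagram D T)) (transp (sym_diagram H U))
     == sym_diagram D T) = (U \subset T).
Proof.
move=> partU partT; have partw := sym_diagram_partition partT.
apply/eqP/subsetP => [fixw C CU|sUT]; last first.
  have absorb : compose (sym_diagram H U) (sym_diagram D T) = sym_diagram D T.
    by apply: compose_absorb => // C /sUT; apply: topB_sym_diagram.
  rewrite absorb; apply: (can_inj (@transpK k)).
  by rewrite transp_compose transpK transp_sym_diagram.
rewrite -(mem_topB_sym_diagram D T (partition_neq0 partU CU)) -fixw.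
apply: compose_topB; first exact: compose_partition.
apply: compose_topB; first exact: sym_diagram_partition.
exact: topB_sym_diagram.
Qed.

(** * Half-diagrams *)

Definition arcs k (p : 'I_k -> 'I_k) (D : {set 'I_k}) : {set {set 'I_k}} :=
  [set [set i; p i] | i in ~: D].

Lemma arc_in_arcs k (p : 'I_k -> 'I_k) (D : {set 'I_k}) i :
  i \notin D -> [set i; p i] \in arcs p D.
Proof. by move=> niD; apply/imsetP; exists i; rewrite // inE. Qed.

Section Arcs.

Variables (k : nat) (p : 'I_k -> 'I_k) (D : {set 'I_k}).
Hypotheses (pK : involutive p) (p_defect : {in D, forall i, p i = i}).

Lemma arcs_partition : partition (arcs p D) (~: D).
Proof.
rewrite (_ : arcs p D = preim_partition (fun i => [set i; p i]) (~: D)).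
  exact: preim_partitionP.
apply: eq_in_imset => i; rewrite inE => niD; apply/setP => j.
apply/idP/setIdP => [/set2P[]->|[_ /eqP->]]; rewrite ?set21 // inE ?eqxx //.
rewrite pK setUC; split=> //; apply: contra niD => piD.
by rewrite -(pK i) (p_defect piD).
Qed.

Lemma mem_arcs i j : ([set i; j] \in arcs p D) = (i \notin D) && (j == p i).
Proof.
apply/idP/andP => [ijT|[niD /eqP->]]; last exact: arc_in_arcs.
have niD : i \in ~: D.
  rewrite -(cover_partition arcs_partition); apply/bigcupP.
  by exists [set i; j]; rewrite ?set21.
rewrite inE in niD; split=> //.
have tT := partition_trivIset arcs_partition.
have ijE : [set i; j] = [set i; p i].
  by rewrite -(def_pblock tT ijT (set21 i j))
    (def_pblock tT (arc_in_arcs p niD)) ?set21.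
have := set22 i j; rewrite ijE => /set2P[ji|->//].
by move: ijE (set22 i (p i)) => <-; rewrite ji setUid => /set1P->.
Qed.

End Arcs.

Section Mate.

Variables (k : nat) (T : {set {set 'I_k}}).

Definition mate (i : 'I_k) : 'I_k := odflt i [pick j in pblock T i | j != i].

Hypotheses (tT : trivIset T) (le2T : {in T, forall C : {set 'I_k}, #|C| <= 2}).

Lemma pblock_mate i : i \in cover T -> pblock T i = [set i; mate i].
Proof.
move=> iT; have iTi : i \in pblock T i by rewrite mem_pblock.
rewrite /mate; case: pickP => [j /andP[jT ne_ji]|none] /=.
  apply/esym/eqP; rewrite eqEcard cards2 eq_sym ne_ji le2T ?pblock_mem // andbT.
  by apply/subsetP => l /set2P[]->.
apply/setP => j; rewrite setUid inE; apply/idP/eqP => [jT|-> //].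
by apply/eqP; have := none j; rewrite jT => /negbFE.
Qed.

Lemma mate_id i : i \notin cover T -> mate i = i.
Proof.
move=> niT; rewrite /mate; case: pickP => [j /andP[jT _]|//].
move: jT; rewrite /pblock; case: pickP => [C /andP[CT iC]|_]; last by rewrite inE.
by case/bigcupP: niT; exists C.
Qed.

Lemma mateK : involutive mate.
Proof.
move=> i; have [iT|niT] := boolP (i \in cover T); last by rewrite !mate_id.
have mT : mate i \in pblock T i by rewrite pblock_mate // set22.
have := set21 i (mate i).
rewrite -pblock_mate // -(same_pblock tT mT) pblock_mate; last first.
  by rewrite -mem_pblock (same_pblock tT mT).
by case/set2P => [i_fixed|<- //]; rewrite -!i_fixed.
Qed.

Lemma arcs_mate D : partition T (~: D) -> arcs mate D = T.
Proof.
move=> /and3P[/eqP covT _ T0]; apply/setP => C; rewrite /arcs -covT.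
apply/imsetP/idP => [[i iT ->]|CT]; first by rewrite -pblock_mate ?pblock_mem.
have /set0Pn[i iC] : C != set0 by apply: contraNneq T0 => <-.
have iT : i \in cover T by apply/bigcupP; exists C.
by exists i; rewrite // -pblock_mate // (def_pblock tT CT).
Qed.

End Mate.

Lemma partition_arcs k (D : {set 'I_k}) (T : {set {set 'I_k}}) :
  partition T (~: D) -> {in T, forall C : {set 'I_k}, #|C| <= 2} ->
  exists p : {perm 'I_k},
    [/\ involutive p, {in D, forall i, p i = i} & arcs p D = T].
Proof.
move=> partT le2T; have tT := partition_trivIset partT; have mK := mateK tT le2T.
exists (perm (inv_inj mK)); split=> [i|i iD|]; rewrite ?permE.
- exact: mK.
- by rewrite mate_id // (cover_partition partT) inE iD.
- rewrite -[RHS](arcs_mate tT le2T partT).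
  by apply: eq_imset => i; rewrite permE.
Qed.

Section Planarity.

Variable k : nat.
Implicit Types (B : {set V k}) (C D : {set 'I_k}) (T : {set {set 'I_k}}).
Implicit Types (p : 'I_k -> 'I_k) (v : V k).

Definition crossing B1 B2 : bool :=
  [exists a in B1, exists c in B1, exists b in B2, exists e in B2,
     (pos a < pos b) && (pos b < pos c) && (pos c < pos e)].

Lemma crossingP B1 B2 :
  reflect (exists a b c e, [/\ a \in B1, b \in B2, c \in B1 & e \in B2] /\
             [/\ pos a < pos b, pos b < pos c & pos c < pos e]) (crossing B1 B2).
Proof.
apply: (iffP idP) => [|[a [b [c [e [[aB bC cB eC] [ab bc ce]]]]]]].
  case/exists_inP=> a aB /exists_inP[c cB /exists_inP[b bC /exists_inP[e eC]]].
  by move=> /andP[/andP[ab bc] ce]; exists a, b, c, e.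
apply/exists_inP; exists a => //; apply/exists_inP; exists c => //.
apply/exists_inP; exists b => //; apply/exists_inP; exists e => //.
by rewrite ab bc ce.
Qed.

Lemma planarP (d : diagram k) :
  reflect {in d &, forall B1 B2, B1 != B2 -> ~~ crossing B1 B2} (planar d).
Proof.
apply: (iffP forall_inP) => [nc B1 B2 Bd1 Bd2|nc B1 Bd1].
  by have /forall_inP/(_ B2 Bd2)/implyP := nc B1 Bd1.
by apply/forall_inP => B2 Bd2; apply/implyP; apply: nc.
Qed.

Lemma pos_swapV v : pos (swapV v) + pos v = (2 * k).-1.
Proof. by case: v => i; have := ltn_ord i; rewrite /=; lia. Qed.

Lemma crossing_swapV B1 B2 :
  crossing (@swapV k @: B1) (@swapV k @: B2) = crossing B2 B1.
Proof.
have swap_cross B B' : crossing B B' -> crossing (@swapV k @: B') (@swapV k @: B).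
  case/crossingP=> a [b [c [e [[aB bC cB eC] [ab bc ce]]]]]; apply/crossingP.
  exists (swapV e), (swapV c), (swapV b), (swapV a); split; first by rewrite !imset_f.
  move: (pos_swapV a) (pos_swapV b) (pos_swapV c) (pos_swapV e) => pa pb pc pe.
  by split; lia.
apply/idP/idP => [/swap_cross|/swap_cross//].
by rewrite !imset_swapVK.
Qed.

Lemma no_crossing_strand_strand i j : crossing (@strand k i) (strand j) = false.
Proof.
apply/crossingP => -[a [b [c [e [[+ + + +] [+ + +]]]]]]; rewrite !in_strand.
by case: a b c e => a [] b [] c [] e /eqP-> /eqP-> /eqP-> /eqP-> /=; lia.
Qed.

Lemma no_crossing_strand_topB i C : crossing (@strand k i) (topB C) = false.
Proof.
apply/crossingP => -[a [b [c [e [[+ + + +] [+ + +]]]]]]; rewrite !in_blockE.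
case: e => // e; case: a b c => a [] b [] c // /eqP-> _ /eqP-> _ /=.
all: by have := ltn_ord e; lia.
Qed.

Lemma no_crossing_topB_botB C C' : crossing (@topB k C) (botB C') = false.
Proof.
apply/crossingP => -[a [b [c [e [[+ + + +] [+ + +]]]]]]; rewrite !in_blockE.
by case: c b => c [] b //= *; have := ltn_ord c; have := ltn_ord b; lia.
Qed.

Lemma no_crossing_botB_topB C C' : crossing (@botB k C) (topB C') = false.
Proof.
apply/crossingP => -[a [b [c [e [[+ + + +] [+ + +]]]]]]; rewrite !in_blockE.
by case: a b => a [] b //= *; have := ltn_ord a; have := ltn_ord b; lia.
Qed.

Lemma planar_sym_diagramP D T :
  reflect ({in T &, forall C C', C != C' -> ~~ crossing (topB C) (topB C')} /\
           {in T & D, forall C i, ~~ crossing (topB C) (@strand k i)})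
          (planar (sym_diagram D T)).
Proof.
apply: (iffP (planarP _)) => [nc|[ncT ncD] B1 B2].
  split=> [C C' CT C'T neqC|C i CT iD]; apply: nc.
  - exact: topB_sym_diagram.
  - exact: topB_sym_diagram.
  - by rewrite (inj_eq (@topB_inj k)).
  - exact: topB_sym_diagram.
  - exact: strand_sym_diagram.
  - by apply/eqP => /setP/(_ (inr i)); rewrite !in_blockE eqxx.
case/sym_diagramP=> -[x xT ->] /sym_diagramP[][y yT ->].
- by rewrite no_crossing_strand_strand.
- by rewrite no_crossing_strand_topB.
- by rewrite -swapV_strand -swapV_topB crossing_swapV ncD.
- by rewrite ncD.
- by rewrite (inj_eq (@topB_inj k)); apply: ncT.
- by rewrite no_crossing_topB_botB.
- by rewrite -swapV_strand -swapV_topB crossing_swapV no_crossing_strand_topB.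
- by rewrite no_crossing_botB_topB.
- rewrite -!swapV_topB crossing_swapV => neq_yx; apply: ncT => //.
  by apply: contraNneq neq_yx => ->.
Qed.

Definition noncrossing p D : bool :=
  [forall a : 'I_k, forall b : 'I_k, (a < b < p a) ==> (b \notin D) && (p b <= p a)].

Lemma noncrossingP p D :
  reflect (forall a b : 'I_k, a < b < p a -> b \notin D /\ p b <= p a)
          (noncrossing p D).
Proof.
apply: (iffP forallP) => [nc a b ab|nc a].
  by have /forallP/(_ b) := nc a; rewrite ab => /andP.
by apply/forallP => b; apply/implyP => /nc/andP.
Qed.

Lemma arc_other_end p (i a b : 'I_k) : involutive p ->
  a \in [set i; p i] -> b \in [set i; p i] -> a < b -> b = p a.
Proof. by move=> pK /set2P[]-> /set2P[]->; rewrite ?pK ?ltnn. Qed.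

Lemma planar_arcs p D :
  involutive p -> {in D, forall i, p i = i} ->
  planar (sym_diagram D (arcs p D)) = noncrossing p D.
Proof.
move=> pK p_defect; apply/planar_sym_diagramP/noncrossingP => [[ncT ncD] a b|nc].
  case/andP=> ab ba; have naD : a \notin D.
    by apply/negP => /p_defect pa; rewrite pa ltnNge ltnW in ba.
  have aT := arc_in_arcs p naD.
  have nbD : b \notin D.
    apply/negP => /(ncD _ _ aT)/negP; apply; apply/crossingP.
    exists (inl a), (inl b), (inl (p a)), (inr b).
    rewrite !in_blockE !set21 set22; split; split=> //=.
    by have := ltn_ord b; have := ltn_ord (p a); lia.
  split=> //; rewrite leqNgt; apply/negP => lt_papb.
  have neq_arcs : [set a; p a] != [set b; p b].
    apply: contraTneq (set21 b (p b)) => <-.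
    by apply/set2P => -[] eq_b; move: ab ba; rewrite eq_b ltnn.
  have /negP[] := ncT _ _ aT (arc_in_arcs p nbD) neq_arcs.
  apply/crossingP; exists (inl a), (inl b), (inl (p a)), (inl (p b)).
  by rewrite !in_blockE !set21 !set22.
split=> [_ _ /imsetP[i _ ->] /imsetP[j _ ->] _|_ j /imsetP[i _ ->] jD].
  apply/crossingP => -[a [b [c [e [[+ + + +] [+ + +]]]]]]; rewrite !in_topB.
  case: a b c e => a [] b [] c [] e // ai bj ci ej /= ab bc ce.
  have ca := arc_other_end pK ai ci (ltn_trans ab bc).
  have eb := arc_other_end pK bj ej (ltn_trans bc ce).
  have /nc[_] : a < b < p a by rewrite -ca ab.
  by rewrite -ca -eb leqNgt ce.
apply/crossingP => -[a [b [c [e [[+ + + +] [+ + +]]]]]]; rewrite !in_blockE.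
case: a b c => a [] b [] c // ai /eqP-> ci _ /= aj jc _; last first.
  by move: jc; have := ltn_ord c; have := ltn_ord j; lia.
have ca := arc_other_end pK ai ci (ltn_trans aj jc).
by have /nc[] : a < j < p a; rewrite -ca ?aj ?jD.
Qed.

End Planarity.

Section BlockSizes.

Variables (A : Alg) (k : nat).
Implicit Types (B : {set V k}) (C D : {set 'I_k}).

Definition admissible_block B : bool :=
  match A with
  | TL => #|B| == 2
  | Motz => (#|B| == 1) || (#|B| == 2)
  | PRook => (#|[set i | (inl i : V k) \in B]| <= 1) &&
             (#|[set j | (inr j : V k) \in B]| <= 1)
  end.

Definition admissible_size (n : nat) : bool :=
  match A with TL => n == 2 | Motz => (n == 1) || (n == 2) | PRook => n <= 1 end.

Lemma blockcondE (d : diagram k) : blockcond A d = [forall B in d, admissible_block B].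
Proof. by rewrite /blockcond /admissible_block; case: A. Qed.

Lemma top_trace_topB C : [set i | (inl i : V k) \in topB C] = C.
Proof. by apply/setP => i; rewrite inE in_topB. Qed.

Lemma bot_trace_botB C : [set i | (inr i : V k) \in botB C] = C.
Proof. by apply/setP => i; rewrite inE in_botB. Qed.

Lemma card_topB C : #|topB C| = #|C|.
Proof. by rewrite card_imset // => ? ? []. Qed.

Lemma card_botB C : #|botB C| = #|C|.
Proof. by rewrite card_imset // => ? ? []. Qed.

Lemma admissible_topB C : admissible_block (topB C) = admissible_size #|C|.
Proof.
rewrite /admissible_block /admissible_size card_topB top_trace_topB.
rewrite (_ : [set j | inr j \in topB C] = set0) ?cards0 ?andbT //.
by apply/setP => i; rewrite !inE in_topB.
Qed.

Lemma admissible_botB C : admissible_block (botB C) = admissible_size #|C|.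
Proof.
rewrite /admissible_block /admissible_size card_botB bot_trace_botB.
rewrite (_ : [set j | inl j \in botB C] = set0) ?cards0 //.
by apply/setP => i; rewrite !inE in_botB.
Qed.

Lemma admissible_strand (i : 'I_k) : admissible_block (strand i).
Proof.
have trace1 (f : 'I_k -> V k) : (forall j, (f j \in strand i) = (j == i)) ->
    #|[set j | f j \in strand i]| = 1.
  move=> fE; rewrite -[RHS](cards1 i).
  by apply: eq_card => j; rewrite in_set fE in_set1.
rewrite /admissible_block cards2 !trace1; first by case: A.
  by move=> j; rewrite in_strand.
by move=> j; rewrite in_strand.
Qed.

Lemma admissible_topB_botB C : admissible_block (topB C :|: botB C) -> #|C| <= 1.
Proof.
have cardE : #|topB C :|: botB C| = 2 * #|C|.
  rewrite cardsU card_topB card_botB.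
  rewrite (_ : _ :&: _ = set0) ?cards0 ?subn0 ?mul2n ?addnn //.
  by apply/setP => -[] i; rewrite !inE !in_blockE ?andbF.
rewrite /admissible_block cardE; case: A; [lia|lia|].
case/andP=> + _; rewrite (_ : [set i | _] = C) //.
by apply/setP => i; rewrite !inE !in_blockE orbF.
Qed.

Lemma admissible_size_le2 n : admissible_size n -> n <= 2.
Proof. by rewrite /admissible_size; case: A; lia. Qed.

Lemma blockcond_sym_diagram D (T : {set {set 'I_k}}) :
  blockcond A (sym_diagram D T) = [forall C in T, admissible_size #|C|].
Proof.
rewrite blockcondE; apply/forall_inP/forall_inP => [adm C CT|adm B].
  by rewrite -admissible_topB adm // topB_sym_diagram.
case/sym_diagramP=> -[x xT ->]; first exact: admissible_strand.
  by rewrite admissible_topB adm.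
by rewrite admissible_botB adm.
Qed.

End BlockSizes.

(* The involution exchanges the two ends of each arc, and the set holds the defects. *)
Notation half_data k := ({perm 'I_k} * {set 'I_k})%type.

Definition half_to_diagram k (x : half_data k) : diagram k :=
  sym_diagram x.2 (arcs x.1 x.2).

Definition half_diagram k (x : half_data k) : bool :=
  [&& [forall i, x.1 (x.1 i) == i], [forall i in x.2, x.1 i == i] &
      noncrossing x.1 x.2].

Definition admissible (A : Alg) k (x : half_data k) (i : 'I_k) : bool :=
  if x.1 i == i then (i \in x.2) || allows_singletons A else allows_arcs A.

Definition half_diagrams (A : Alg) (k m : nat) : {set half_data k} :=
  [set x | [&& half_diagram x, [forall i, admissible A x i] & #|x.2| == m]].

Lemma half_diagramP k (x : half_data k) :
  reflect [/\ involutive x.1, {in x.2, forall i, x.1 i = i} &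
              forall a b : 'I_k, a < b < x.1 a -> b \notin x.2 /\ x.1 b <= x.1 a]
          (half_diagram x).
Proof.
apply: (iffP and3P) => -[pK p_fix /noncrossingP nc]; split=> //.
- by move=> i; apply/eqP/(forallP pK).
- by move=> i /(forall_inP p_fix)/eqP.
- by apply/forallP => i; rewrite pK.
- by apply/forall_inP => i iD; rewrite p_fix.
Qed.

Lemma half_diagram_arcs k (x : half_data k) :
  half_diagram x -> partition (arcs x.1 x.2) (~: x.2).
Proof. by case/half_diagramP => pK p_fix _; apply: arcs_partition. Qed.

Lemma half_to_diagram_inj k (x y : half_data k) :
  half_diagram x -> half_diagram y -> half_to_diagram x = half_to_diagram y -> x = y.
Proof.
case: x y => [p D] [p' D'] half half' eqd.
have [/= eqD eqT] : D = D' /\ arcs p D = arcs p' D'.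
  apply: sym_diagram_inj eqd; apply/negbT.
    exact: partition0 (half_diagram_arcs half).
  exact: partition0 (half_diagram_arcs half').
congr pair => //; apply/permP => i.
have [pK p_fix _] := half_diagramP _ half; have [p'K p'_fix _] := half_diagramP _ half'.
have [iD|niD] := boolP (i \in D); first by rewrite p_fix // p'_fix // -eqD.
by have := arc_in_arcs p niD; rewrite /= eqT mem_arcs // => /andP[_ /eqP].
Qed.

Lemma blockcond_half_to_diagram A k (x : half_data k) :
  {in x.2, forall i, x.1 i = i} ->
  blockcond A (half_to_diagram x) = [forall i, admissible A x i].
Proof.
move=> p_fix; rewrite blockcond_sym_diagram.
have size_admissible i :
    i \notin x.2 -> admissible_size A #|[set i; x.1 i]| = admissible A x i.
  rewrite /admissible cards2 eq_sym => /negPf->.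
  by rewrite /admissible_size; case: A; case: (x.1 i == i).
apply/forall_inP/forallP => [adm i|adm C /imsetP[i]].
  have [iD|niD] := boolP (i \in x.2); first by rewrite /admissible p_fix // eqxx iD.
  by rewrite -size_admissible // adm // arc_in_arcs.
by rewrite inE => niD ->; rewrite size_admissible.
Qed.

Lemma symm_mdiag_sym_diagram k (D : {set 'I_k}) (T : {set {set 'I_k}}) :
  partition T (~: D) -> symm_mdiag #|D| (sym_diagram D T).
Proof.
move=> partT.
have disjDT : [disjoint T & set1 @: D].
  apply/pred0Pn => -[C /= /andP[CT /imsetP[i iD Ci]]].
  by have /subsetP/(_ i) := partitionS partT CT; rewrite Ci !inE eqxx iD => /(_ isT).
have TE : (set1 @: D :|: T) :\: set1 @: D = T.
  by rewrite setDUl setDv set0U; apply/setDidPl.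
apply/existsP; exists (set1 @: D :|: T); apply/existsP; exists (set1 @: D).
apply/and4P; split.
- rewrite -(setUCr D); apply: partitionU (partition_set1 D) partT _.
  by rewrite disjoints_subset setCK.
- exact: subsetUl.
- by rewrite (card_imset _ set1_inj).
- rewrite TE; apply/eqP; congr (_ :|: _ :|: _).
  by rewrite -imset_comp; apply: eq_imset => i /=; rewrite topB_botB_set1.
Qed.

Lemma symm_mdiag_inv A k m (w : diagram k) : symm_mdiag m w -> blockcond A w ->
  exists D T, [/\ partition T (~: D), #|D| = m & w = sym_diagram D T].
Proof.
move=> /existsP[Q /existsP[P /and4P[partQ sPQ /eqP cardP /eqP wE]]].
rewrite blockcondE => /forall_inP adm.
have single : {in P, forall B : {set 'I_k}, #|B| = 1}.
  move=> B BP; apply/eqP; rewrite eqn_leq card_gt0.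
  rewrite (partition_neq0 partQ (subsetP sPQ B BP)) andbT.
  apply: (@admissible_topB_botB A); apply: adm.
  by rewrite wE !in_setU (imset_f (fun B => topB B :|: botB B)).
have PE := esym (imset_set1_cover single).
exists (cover P), (Q :\: P); split.
- by rewrite -setTD; apply: partitionD.
- by rewrite -cardP [in RHS]PE (card_imset _ set1_inj).
- rewrite wE; congr (_ :|: _ :|: _); rewrite [in LHS]PE -imset_comp.
  by apply: eq_imset => i /=; rewrite topB_botB_set1.
Qed.

Lemma modBasisE A k m : modBasis A k m = @half_to_diagram k @: half_diagrams A k m.
Proof.
apply/setP => w; rewrite inE; apply/andP/imsetP.
  case=> symw /and3P[_ planarw admw].
  have [D [T [partT cardD wE]]] := symm_mdiag_inv symw admw.
  have le2T : {in T, forall C : {set 'I_k}, #|C| <= 2}.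
    move: admw; rewrite wE blockcond_sym_diagram => /forall_inP adm C CT.
    exact/admissible_size_le2/adm.
  have [p [pK p_fix arcsE]] := partition_arcs partT le2T.
  have w_half : w = half_to_diagram (p, D) by rewrite /half_to_diagram arcsE.
  exists (p, D) => //; rewrite inE /= cardD eqxx andbT.
  rewrite -blockcond_half_to_diagram // -w_half admw andbT.
  apply/half_diagramP; split=> //=.
  by apply/noncrossingP; rewrite -planar_arcs // arcsE -wE.
case=> x; rewrite inE => /and3P[half adm /eqP cardD] ->.
have [pK p_fix nc] := half_diagramP _ half.
rewrite -cardD symm_mdiag_sym_diagram ?half_diagram_arcs //; split=> //.
apply/and3P; split.
- exact/sym_diagram_partition/half_diagram_arcs.
- by rewrite planar_arcs //; apply/noncrossingP.
- by rewrite blockcond_half_to_diagram.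
Qed.

Lemma trD_sym_diagram (n : nat) A k m (H : {set 'I_k}) U :
  partition U (~: H) ->
  trD n A m (sym_diagram H U) =
  ((n%:R : rat) ^+ #|U|
   * #|[set x in half_diagrams A k m | U \subset arcs x.1 x.2]|%:R)%R.
Proof.
move=> partU; rewrite /trD modBasisE big_imset /=; last first.
  move=> x y; rewrite !inE => /and3P[hx _ _] /and3P[hy _ _].
  exact: half_to_diagram_inj.
transitivity (\sum_(x in half_diagrams A k m | U \subset arcs x.1 x.2)
  (n%:R : rat) ^+ #|U|)%R.
  rewrite big_mkcondr; apply: eq_bigr => x; rewrite inE => /and3P[half _ /eqP cardD].
  have partT := half_diagram_arcs half.
  rewrite sym_diagram_fixed //; case: ifP => [sub|_]; last by rewrite mulr0.
  have fixw := sym_diagram_fixed partU partT; rewrite sub in fixw.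
  rewrite (eqP fixw) nprop_sym_diagram cardD eqxx mulr1 ell_absorb //.
    exact: sym_diagram_partition.
  by move=> C /(subsetP sub); apply: topB_sym_diagram.
rewrite sumr_const mulr_natr; congr (_ *+ _)%R.
by apply: eq_card => x; rewrite [RHS]inE.
Qed.

(** * Removing the last point of a half-diagram *)

Section LastDefect.

Variables (k : nat) (rho : 'I_k).
Implicit Type D : {set 'I_k}.

Definition last_defect D : 'I_k := odflt rho [pick j in D | [forall d in D, d <= j]].

Lemma last_defect_eq D j :
  j \in D -> {in D, forall d : 'I_k, d <= j} -> last_defect D = j.
Proof.
move=> jD maxj; rewrite /last_defect; case: pickP => [l|/(_ j)].
  case/andP=> lD /forall_inP maxl; apply/val_inj/eqP.
  by rewrite eqn_leq maxj ?maxl.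
by rewrite jD => /negP[]; apply/forall_inP.
Qed.

Lemma last_defectP D : D != set0 ->
  last_defect D \in D /\ {in D, forall d : 'I_k, d <= last_defect D}.
Proof.
case/set0Pn=> d dD; have [j jD maxj] := arg_maxnP (fun i : 'I_k => i : nat) dD.
by rewrite (last_defect_eq jD maxj).
Qed.

End LastDefect.

Section TailedHalfDiagrams.

Variables (A : Alg) (k : nat) (sigma : 'I_k -> 'I_k).

(* Prescribing the points from [r] on, instead of deleting them, keeps all the
   half-diagrams of the recursion on the same [k] points. *)
Definition tailed_half_diagrams (r m : nat) : {set half_data k} :=
  [set x : half_data k | [&& half_diagram x,
     [forall i : 'I_k, if i < r then admissible A x i
                       else (i \notin x.2) && (x.1 i == sigma i)] & #|x.2| == m]].

Lemma tailedP r m (x : half_data k) :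
  reflect [/\ half_diagram x, forall i : 'I_k, i < r -> admissible A x i,
              forall i : 'I_k, r <= i -> i \notin x.2 /\ x.1 i = sigma i & #|x.2| = m]
          (x \in tailed_half_diagrams r m).
Proof.
rewrite inE; apply: (iffP and3P) => [[half /forallP loc /eqP cardD]|].
  by split=> // i; have := loc i; case: ltnP => // _ /andP[iD /eqP].
case=> half adm tail cardD; split=> //; last exact/eqP.
by apply/forallP => i; case: ltnP => [/adm//|/tail[-> ->]]; rewrite eqxx.
Qed.

Hypothesis sigmaK : involutive sigma.

Lemma card_tailed0 m : noncrossing sigma set0 -> #|tailed_half_diagrams 0 m| = (m == 0).
Proof.
move=> /noncrossingP sigma_nc.
have [->|m_neq0] := eqVneq m 0; last first.
  apply: eq_card0 => x; apply/negbTE/negP => /tailedP[_ _ tail cardD].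
  have /set0Pn[i iD] : x.2 != set0 by rewrite -card_gt0 cardD lt0n.
  by have [] := tail i; rewrite ?iD.
apply: (@eq_card1 _ (perm (inv_inj sigmaK), set0)) => -[p D].
apply/tailedP/eqP => [[_ _ /= tail /eqP]|[-> ->]].
  rewrite cards_eq0 => /eqP->; congr pair; apply/permP => i.
  by rewrite permE; have [] := tail i.
split=> //=; last exact: cards0.
  apply/half_diagramP; split=> [i|i|a b] /=; rewrite !permE //; first by rewrite inE.
  exact: sigma_nc.
by move=> i _; rewrite inE permE.
Qed.

Lemma tailed_tail_stable r m x : (forall i : 'I_k, i < r -> sigma i = i) ->
  x \in tailed_half_diagrams r m -> forall i : 'I_k, r <= i -> r <= x.1 i.
Proof.
move=> sigma_fix /tailedP[_ _ tail _] i le_ri; have [_ ->] := tail i le_ri.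
rewrite leqNgt; apply/negP => lt_sr; move: (sigma_fix _ lt_sr).
by rewrite sigmaK => eq_i; rewrite -eq_i ltnNge le_ri in lt_sr.
Qed.

Lemma tailed_head_stable r m x : (forall i : 'I_k, i < r -> sigma i = i) ->
  x \in tailed_half_diagrams r m -> forall i : 'I_k, i < r -> x.1 i < r.
Proof.
move=> sigma_fix tx i; rewrite !ltnNge; apply: contra.
have [/half_diagramP[pK _ _] _ _ _] := tailedP _ _ _ tx.
by move/(tailed_tail_stable sigma_fix tx); rewrite pK.
Qed.

Variable rho : 'I_k.
Hypothesis sigma_fix : forall i : 'I_k, i <= rho -> sigma i = i.

Let sigma_fixlt (i : 'I_k) : i < rho -> sigma i = i.
Proof. by move/ltnW; apply: sigma_fix. Qed.

Lemma card_tailed_isolated m :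
  #|[set x in tailed_half_diagrams rho.+1 m | (rho \notin x.2) && (x.1 rho == rho)]| =
  allows_singletons A * #|tailed_half_diagrams rho m|.
Proof.
case allowed: (allows_singletons A); rewrite ?mul1n ?mul0n; last first.
  apply: eq_card0 => x; apply/negbTE/negP.
  rewrite inE => /and3P[/tailedP[_ adm _ _] /negPf rhoD /eqP p_rho].
  by have := adm rho (leqnn _); rewrite /admissible p_rho eqxx rhoD allowed.
apply: eq_card => x; rewrite inE; apply/and3P/tailedP.
  case=> /tailedP[half adm tail cardD] rhoD /eqP p_rho; split=> // i.
    by move/ltnW; apply: adm.
  rewrite leq_eqVlt => /predU1P[/val_inj<-|]; last exact: tail.
  by rewrite sigma_fix.
case=> half adm tail cardD; have [rhoD p_rho] := tail rho (leqnn _).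
rewrite sigma_fix // in p_rho; rewrite rhoD p_rho; split=> //.
apply/tailedP; split=> // i.
  rewrite ltnS leq_eqVlt => /predU1P[/val_inj->|]; last exact: adm.
  by rewrite /admissible p_rho eqxx allowed orbT.
by move/ltnW; apply: tail.
Qed.

Definition add_defect (x : half_data k) : half_data k := (x.1, rho |: x.2).
Definition remove_defect (x : half_data k) : half_data k := (x.1, x.2 :\ rho).

Lemma add_defect_tailed m x : x \in tailed_half_diagrams rho m ->
  add_defect x \in [set y in tailed_half_diagrams rho.+1 m.+1 | rho \in y.2].
Proof.
move=> tx; rewrite inE setU11 andbT.
have stable := tailed_tail_stable sigma_fixlt tx.
have [/half_diagramP[pK p_fix nc] adm tail cardD] := tailedP _ _ _ tx.
have [rhoD] := tail rho (leqnn _); rewrite sigma_fix // => p_rho.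
apply/tailedP; split=> /= [|i|i lt_i|]; last by rewrite cardsU1 rhoD cardD.
- apply/half_diagramP; split=> //= [i /setU1P[->|/p_fix]|a b ab] //.
  have [bD pb] := nc a b ab; split=> //; rewrite !inE negb_or bD andbT.
  apply/eqP => b_rho; case/andP: ab; rewrite b_rho => lt_a lt_pa.
  by have := stable _ (ltnW lt_pa); rewrite pK leqNgt lt_a.
- rewrite ltnS leq_eqVlt => /predU1P[/val_inj->|/adm].
    by rewrite /admissible p_rho eqxx setU11.
  by rewrite /admissible; case: ifP => //= _ /orP[iD|->]; rewrite ?orbT // !inE iD orbT.
- have [iD pi] := tail i (ltnW lt_i); split=> //; rewrite !inE negb_or iD andbT.
  by apply: contraTneq lt_i => ->; rewrite ltnn.
Qed.

Lemma remove_defect_tailed m x :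
  x \in tailed_half_diagrams rho.+1 m.+1 -> rho \in x.2 ->
  remove_defect x \in tailed_half_diagrams rho m.
Proof.
move=> /tailedP[/half_diagramP[pK p_fix nc] adm tail cardD] rhoD.
apply/tailedP; split=> /= [|i lt_i|i|].
- apply/half_diagramP; split=> //= [i /setD1P[_ /p_fix]|a b /nc[bD pb]] //.
  by rewrite !inE (negPf bD) andbF.
- have := adm i (ltnW lt_i); rewrite /admissible !inE.
  by rewrite (_ : i != rho) //; apply: contraTneq lt_i => ->; rewrite ltnn.
- rewrite leq_eqVlt => /predU1P[/val_inj<-|/tail[iD pi]].
    by rewrite !inE eqxx sigma_fix // p_fix.
  by rewrite !inE (negPf iD) andbF.
- by have := cardsD1 rho x.2; rewrite rhoD cardD => -[].
Qed.

Lemma card_tailed_defect m :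
  #|[set x in tailed_half_diagrams rho.+1 m | rho \in x.2]| =
  if m is m'.+1 then #|tailed_half_diagrams rho m'| else 0.
Proof.
case: m => [|m].
  apply: eq_card0 => x; apply/negbTE/negP.
  rewrite inE => /andP[/tailedP[_ _ _ /eqP]].
  by rewrite cards_eq0 => /eqP->; rewrite inE.
apply: (card_in_can2 (f := remove_defect) (g := add_defect)).
- by move=> x; rewrite inE => /andP[]; apply: remove_defect_tailed.
- by move=> x; apply: add_defect_tailed.
- by case=> p D; rewrite inE => /andP[_ rhoD]; congr pair; rewrite /= setD1K.
- case=> p D /tailedP[_ _ tail _]; congr pair; rewrite /= setU1K //.
  by have [] := tail rho (leqnn _).
Qed.

(* The left end of the last arc becomes the last defect. *)
Definition open_arc (x : half_data k) : half_data k :=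
  ((x.1 * tperm rho (x.1 rho))%g, x.1 rho |: x.2).
Definition close_arc (x : half_data k) : half_data k :=
  ((x.1 * tperm rho (last_defect rho x.2))%g, x.2 :\ last_defect rho x.2).

Lemma last_arc_innermost m x : x \in tailed_half_diagrams rho.+1 m -> x.1 rho != rho ->
  [/\ x.1 rho < rho, x.1 rho \notin x.2 & {in x.2, forall d : 'I_k, d < x.1 rho}].
Proof.
move=> tx p_rho; have := tailed_head_stable (r := rho.+1) sigma_fix tx (leqnn _).
have [/half_diagramP[pK p_fix nc] _ tail _] := tailedP _ _ _ tx.
rewrite ltnS leq_eqVlt (inj_eq val_inj) (negPf p_rho) /= => lt_p.
have notD : x.1 rho \notin x.2 by apply: contra p_rho => /p_fix; rewrite pK => <-.
split=> // d dD; rewrite ltnNge leq_eqVlt (inj_eq val_inj) negb_or.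
apply/andP; split; first by apply: contraNneq notD => ->.
apply: contraL dD => lt_d; have [lt_drho|] := ltnP d rho.
  by have [] := nc (x.1 rho) d; rewrite ?pK ?lt_d.
rewrite leq_eqVlt => /predU1P[/val_inj<-|/tail[]//].
by apply: contraNN p_rho => /p_fix->.
Qed.

Lemma open_arc_half m x : x \in tailed_half_diagrams rho.+1 m -> x.1 rho != rho ->
  half_diagram (open_arc x).
Proof.
move=> tx p_rho; have [lt_j jD _] := last_arc_innermost tx p_rho.
have stable := tailed_tail_stable (r := rho.+1) sigma_fix tx.
have [/half_diagramP[pK p_fix nc] _ _ _] := tailedP _ _ _ tx.
have qE i := mul_tperm_imageE rho i pK.
apply/half_diagramP; split=> /= [|i /setU1P[->|iD]|a b].
- by apply: mul_tperm_invol; rewrite // pK tpermC.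
- by rewrite qE eqxx orbT.
- by rewrite qE (p_fix i iD) if_same.
rewrite !qE; have [_|/norP[_ ne_aj]] := boolP ((a == rho) || (a == x.1 rho)).
  by move=> /andP[/ltn_trans lt_ab /lt_ab]; rewrite ltnn.
move=> ab; have [bD pb] := nc a b ab; case/andP: ab => lt_ab lt_ba.
split; last by case: ifP => // _; apply: ltnW.
rewrite !inE negb_or bD andbT; apply/eqP => b_j.
rewrite b_j pK leq_eqVlt (inj_eq val_inj) in pb lt_ab.
case/predU1P: pb => [rho_pa|/stable].
  by rewrite rho_pa pK eqxx in ne_aj.
by rewrite pK leqNgt (ltn_trans lt_ab (leqW lt_j)).
Qed.

Lemma open_arc_tailed m x : x \in tailed_half_diagrams rho.+1 m -> x.1 rho != rho ->
  open_arc x \in tailed_half_diagrams rho m.+1.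
Proof.
move=> tx p_rho; have [lt_j jD _] := last_arc_innermost tx p_rho.
have [/half_diagramP[pK p_fix _] adm tail cardD] := tailedP _ _ _ tx.
have qE i := mul_tperm_imageE rho i pK.
apply/tailedP; split=> /= [|i lt_i|i|].
- exact: open_arc_half tx p_rho.
- have := adm i (ltnW lt_i).
  rewrite /admissible qE !inE [i == rho](ltn_eqF lt_i) /=.
  by have [->|] := eqVneq i (x.1 rho); rewrite ?eqxx.
- rewrite leq_eqVlt qE !inE => /predU1P[/val_inj<-|lt_i].
    rewrite eqxx sigma_fix // negb_or eq_sym p_rho; split=> //.
    by apply: contraNN p_rho => /p_fix ->.
  have [/negPf-> ->] := tail i lt_i.
  rewrite [i == rho](gtn_eqF lt_i) [i == x.1 rho](gtn_eqF (ltn_trans lt_j lt_i)).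
  by split.
- by rewrite cardsU1 jD cardD.
Qed.

Lemma last_defect_tailed m x : x \in tailed_half_diagrams rho m.+1 ->
  let j := last_defect rho x.2 in
  [/\ j < rho, j \in x.2, {in x.2, forall d : 'I_k, d <= j} & x.1 rho = rho].
Proof.
move=> /tailedP[_ _ tail cardD] j.
have /(last_defectP rho)[jD lastj] : x.2 != set0 by rewrite -card_gt0 cardD.
have [_ ->] := tail rho (leqnn _); split; rewrite ?sigma_fix //.
by rewrite ltnNge; apply/negP => /tail[]; rewrite jD.
Qed.

Lemma close_arc_half m x : x \in tailed_half_diagrams rho m.+1 ->
  half_diagram (close_arc x).
Proof.
move=> tx; have stable := tailed_head_stable sigma_fixlt tx.
have [/half_diagramP[qK q_fix nc] _ tail _] := tailedP _ _ _ tx.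
have [] := last_defect_tailed tx; rewrite /close_arc.
set j := last_defect rho x.2 => lt_j jD lastj q_rho.
have pE i := mul_tperm_fixedE i q_rho (q_fix j jD).
have [rhoD _] := tail rho (leqnn _).
apply/half_diagramP; split=> /= [|i /setD1P[/negPf ne_ij iD]|a b].
- by apply: mul_tperm_invol; rewrite // q_rho q_fix.
- by rewrite pE ne_ij q_fix //; case: eqP => // i_rho; rewrite -i_rho iD in rhoD.
have [->|ne_a] := eqVneq a rho.
  by rewrite pE eqxx => /andP[lt_b /(ltn_trans lt_b)/(ltn_trans lt_j)]; rewrite ltnn.
have [->|ne_aj] := eqVneq a j.
  rewrite (pE j) [j == rho](ltn_eqF lt_j) eqxx => /andP[lt_jb lt_b].
  rewrite pE [b == rho](ltn_eqF lt_b) [b == j](gtn_eqF lt_jb) ltnW ?stable //.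
  split=> //; rewrite !inE; apply/nandP; right.
  by apply/negP => /lastj; rewrite leqNgt lt_jb.
rewrite (pE a) (negPf ne_a) (negPf ne_aj) => ab.
have [bD qb] := nc a b ab; rewrite !inE (negPf bD) andbF; split=> //.
rewrite pE; case: eqP => [b_rho|_].
  by apply: ltnW; case/andP: ab => _; rewrite b_rho; apply: ltn_trans.
by case: eqP => // b_j; rewrite b_j jD in bD.
Qed.

Lemma close_arc_tailed m x : allows_arcs A -> x \in tailed_half_diagrams rho m.+1 ->
  close_arc x \in tailed_half_diagrams rho.+1 m /\ (close_arc x).1 rho != rho.
Proof.
move=> allowed tx; have half := close_arc_half tx.
have [/half_diagramP[_ q_fix _] adm tail cardD] := tailedP _ _ _ tx.
have [] := last_defect_tailed tx; move: half; rewrite /close_arc.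
set j := last_defect rho x.2 => half lt_j jD _ q_rho.
have pE i := mul_tperm_fixedE i q_rho (q_fix j jD).
have ne_j : j == rho = false := ltn_eqF lt_j.
split; last by rewrite /= pE eqxx ne_j.
apply/tailedP; split=> //= [i|i lt_i|].
- rewrite ltnS leq_eqVlt => /predU1P[/val_inj->|lt_i].
    by rewrite /admissible pE eqxx ne_j.
  have := adm i lt_i; rewrite /admissible pE !inE [i == rho](ltn_eqF lt_i).
  by have [->|//] := eqVneq i j; rewrite (eq_sym rho) ne_j.
- have [iD q_i] := tail i (ltnW lt_i).
  rewrite !inE (negPf iD) andbF pE [i == rho](gtn_eqF lt_i).
  by case: eqP => // i_j; rewrite i_j jD in iD.
- by have := cardsD1 j x.2; rewrite jD cardD => -[].
Qed.

Lemma card_tailed_arc m :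
  #|[set x in tailed_half_diagrams rho.+1 m | x.1 rho != rho]| =
  allows_arcs A * #|tailed_half_diagrams rho m.+1|.
Proof.
case allowed: (allows_arcs A); rewrite ?mul1n ?mul0n; last first.
  apply: eq_card0 => x; apply/negbTE/negP.
  rewrite inE => /andP[/tailedP[_ adm _ _] /negPf p_rho].
  by have := adm rho (leqnn _); rewrite /admissible p_rho allowed.
apply: (card_in_can2 (f := open_arc) (g := close_arc)) => [x|x tx|[p D]|[p D] tx].
- by rewrite inE => /andP[]; apply: open_arc_tailed.
- by rewrite inE; apply/andP; apply: close_arc_tailed.
- rewrite inE => /andP[tx p_rho]; have [/= _ jD lastj] := last_arc_innermost tx p_rho.
  rewrite /close_arc /= (@last_defect_eq _ _ _ (p rho)) ?setU11 //.
    by rewrite setU1K // -mulgA tperm2 mulg1.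
  by move=> d /setU1P[->|/lastj/ltnW].
- have [/= _ jD _ p_rho] := last_defect_tailed tx.
  by rewrite /open_arc /= permM p_rho tpermL setD1K // -mulgA tperm2 mulg1.
Qed.

Lemma card_tailed_succ m :
  #|tailed_half_diagrams rho.+1 m| =
  (if m is m'.+1 then #|tailed_half_diagrams rho m'| else 0)
  + allows_singletons A * #|tailed_half_diagrams rho m|
  + allows_arcs A * #|tailed_half_diagrams rho m.+1|.
Proof.
rewrite -card_tailed_defect -card_tailed_isolated -card_tailed_arc.
have : {in tailed_half_diagrams rho.+1 m,
    forall x : half_data k, rho \in x.2 -> x.1 rho = rho}.
  by move=> x /tailedP[/half_diagramP[_ p_fix _] _ _ _] /p_fix.
move: (tailed_half_diagrams rho.+1 m) => S defect_fixed.
rewrite -(cardsID [set x : half_data k | x.1 rho != rho] S) addnC.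
rewrite -(cardsID [set x : half_data k | rho \in x.2] (S :\: _)).
congr (_ + _ + _); apply: eq_card => x; rewrite !inE ?negbK //.
all: have [xS|] := boolP (x \in S); rewrite ?andbF // andbT.
  by case: (boolP (rho \in x.2)) => [/(defect_fixed x xS)->|]; rewrite ?eqxx ?andbF.
by rewrite andbC.
Qed.

End TailedHalfDiagrams.

Lemma card_tailed A k (sigma : 'I_k -> 'I_k) r m :
  involutive sigma -> noncrossing sigma set0 ->
  r <= k -> (forall i : 'I_k, i < r -> sigma i = i) ->
  #|tailed_half_diagrams A sigma r m| = path_count A r m.
Proof.
move=> sigmaK sigma_nc; elim: r m => [|r IH] m le_rk sigma_fix.
  exact: card_tailed0.
have IHr l : #|tailed_half_diagrams A sigma r l| = path_count A r l.
  by apply: IH => [|i lt_i]; [exact: ltnW | apply/sigma_fix/ltnW].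
rewrite (card_tailed_succ A sigmaK (rho := Ordinal le_rk)) //= !IHr.
by case: m => [|m]; rewrite ?IHr.
Qed.

Definition head_points (k r : nat) : {set 'I_k} := [set i : 'I_k | i < r].

Lemma tailed_half_diagramsE A k (sigma : 'I_k -> 'I_k) r m :
  (forall i : 'I_k, r <= i ->
    if sigma i == i then allows_singletons A else allows_arcs A) ->
  [set x in half_diagrams A k m | arcs sigma (head_points k r) \subset arcs x.1 x.2] =
  tailed_half_diagrams A sigma r m.
Proof.
move=> adm_sigma; apply/setP => x; rewrite !inE.
have [half|] := boolP (half_diagram x) => //=.
have [pK p_fix _] := half_diagramP _ half.
rewrite andbAC; congr (_ && _).
have tailE : (arcs sigma (head_points k r) \subset arcs x.1 x.2) =
    [forall i : 'I_k, (r <= i) ==> (i \notin x.2) && (x.1 i == sigma i)].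
  apply/subsetP/forall_inP => [sub i le_ri|tail C /imsetP[i]].
    by rewrite eq_sym -mem_arcs // sub // arc_in_arcs // inE -leqNgt.
  by rewrite !inE -leqNgt => /tail; rewrite eq_sym -mem_arcs // => ? ->.
rewrite tailE; apply/andP/forallP => [[/forallP adm /forallP tail] i|loc].
  by case: ltnP => // le_ri; apply: implyP le_ri.
split; apply/forallP => i; last by have := loc i; rewrite ltnNge; case: (r <= i).
have := loc i; case: ltnP => // /adm_sigma adm_i /andP[_ /eqP p_i].
by rewrite /admissible p_i; case: ifP adm_i => // _ ->; rewrite orbT.
Qed.

(** * The character *)

Definition interval_tiling (c k : nat) (S : {set 'I_k}) (T : {set {set 'I_k}}) : Prop :=
  partition T S /\
  {in T, forall B : {set 'I_k}, #|B| = c /\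
     forall x y z : 'I_k, x \in B -> z \in B -> x < y < z -> y \in B}.

Lemma interval_tiling_setT c : 0 < c -> interval_tiling c [set: 'I_c] [set setT].
Proof.
move=> c_gt0; split=> [|_ /set1P->]; last first.
  by rewrite cardsT card_ord; split=> // *; rewrite inE.
apply/and3P; split; rewrite ?cover1 ?trivIset1 //.
by rewrite inE eq_sym -cards_eq0 cardsT card_ord -lt0n.
Qed.

Lemma interval_tilingU c k (S1 S2 : {set 'I_k}) T1 T2 : [disjoint S1 & S2] ->
  interval_tiling c S1 T1 -> interval_tiling c S2 T2 ->
  interval_tiling c (S1 :|: S2) (T1 :|: T2).
Proof.
move=> dS [part1 int1] [part2 int2]; split; first exact: partitionU.
by move=> B /setUP[/int1|/int2].
Qed.

Lemma interval_tiling_translate c a b (f : 'I_a -> 'I_b) l S T :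
  (forall i, f i = l + i :> nat) -> interval_tiling c S T ->
  interval_tiling c (f @: S) [set f @: (B : {set 'I_a}) | B in T].
Proof.
move=> fE [partT intT].
have f_inj : injective f.
  by move=> i j /(congr1 val)/eqP; rewrite /= !fE eqn_add2l => /eqP/val_inj.
split; first by rewrite imset_partition.
move=> _ /imsetP[B BT ->]; have [cardB intB] := intT B BT.
split=> [|_ y _ /imsetP[x xB ->] /imsetP[z zB ->]]; first by rewrite card_imset.
rewrite !fE => /andP[lt_xy lt_yz].
have lt_a : y - l < a by have := ltn_ord z; lia.
have -> : y = f (Ordinal lt_a) by apply: val_inj; rewrite /= fE /=; lia.
by apply/imset_f/(intB x _ z) => //=; lia.
Qed.

Lemma sym_diagramU k (D1 D2 : {set 'I_k}) T1 T2 :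
  sym_diagram D1 T1 :|: sym_diagram D2 T2 = sym_diagram (D1 :|: D2) (T1 :|: T2).
Proof.
by rewrite /sym_diagram !imsetU [LHS]setUACA; congr (_ :|: _); apply: setUACA.
Qed.

Lemma map_sym_diagram a b (g : V a -> V b) (f : 'I_a -> 'I_b) D T :
  (forall i, g (inl i) = inl (f i)) -> (forall i, g (inr i) = inr (f i)) ->
  [set g @: (B : {set V a}) | B in sym_diagram D T] =
  sym_diagram (f @: D) [set f @: (C : {set 'I_a}) | C in T].
Proof.
move=> g_inl g_inr; rewrite /sym_diagram !imsetU -!imset_comp.
congr (_ :|: _ :|: _); apply: eq_imset => x /=.
- by rewrite /strand imsetU !imset_set1 g_inl g_inr.
- by rewrite /topB -!imset_comp; apply: eq_imset => i; apply: g_inl.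
- by rewrite /botB -!imset_comp; apply: eq_imset => i; apply: g_inr.
Qed.

Lemma tensor_sym_diagram a b (D1 : {set 'I_a}) T1 (D2 : {set 'I_b}) T2 :
  tensor (sym_diagram D1 T1) (sym_diagram D2 T2) =
  sym_diagram (lshift b @: D1 :|: @rshift a b @: D2)
    ([set lshift b @: (C : {set 'I_a}) | C in T1] :|:
     [set @rshift a b @: (C : {set 'I_b}) | C in T2]).
Proof.
rewrite -sym_diagramU /tensor.
rewrite (@map_sym_diagram _ _ (@liftL a b) (lshift b)) //.
by rewrite (@map_sym_diagram _ _ (@liftR a b) (@rshift a b)).
Qed.

Lemma castD_sym_diagram a b (eq_ab : a = b) (D : {set 'I_a}) T :
  castD eq_ab (sym_diagram D T) =
  sym_diagram (cast_ord eq_ab @: D) [set cast_ord eq_ab @: (C : {set 'I_a}) | C in T].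
Proof. exact: map_sym_diagram. Qed.

Lemma idD_sym_diagram r : idD r = sym_diagram setT set0.
Proof.
rewrite /sym_diagram !imset0 !setU0; apply/setP => B.
by apply/imsetP/imsetP => -[i _ ->]; exists i.
Qed.

Definition gen_diagram (A : Alg) : diagram (cA A) :=
  match A return diagram (cA A) with TL => frakE | _ => frakP end.

Lemma gen_diagram_sym A : gen_diagram A = sym_diagram set0 [set setT].
Proof.
have setT1 : [set: 'I_1] = [set ord0] by apply/setP => i; rewrite !inE ord1.
have setT2 : [set: 'I_2] = [set ord0; ord_max].
  by apply/setP => -[[|[|i]] lt_i]; rewrite !inE.
rewrite /sym_diagram imset0 set0U !imset_set1.
by case: A; rewrite /= ?setT1 ?setT2 /topB /botB ?imsetU ?imset_set1.
Qed.

Lemma cA_gt0 A : 0 < cA A. Proof. by case: A. Qed.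

Fixpoint powD c (d : diagram c) (s : nat) : diagram (s * c) :=
  match s return diagram (s * c) with
  | 0 => emptyD
  | s'.+1 => castD (esym (mulSnr s' c)) (tensor (powD d s') d)
  end.

Lemma powE_singleton c (x : rat) (d : diagram c) s :
  powE [:: (x, d)] s = [:: (x ^+ s, powD d s)]%R.
Proof. by elim: s => [|s IH] //=; rewrite IH /= exprSr. Qed.

Lemma powD_interval_tiling A s : exists T,
  powD (gen_diagram A) s = sym_diagram set0 T /\ interval_tiling (cA A) setT T.
Proof.
elim: s => [|s [T [powT tilT]]].
  exists set0; split; first by rewrite /sym_diagram !imset0 !setU0.
  split=> [|B]; last by rewrite inE.
  have -> : [set: 'I_0] = set0 by apply/setP => -[].
  by rewrite partition_set0.
rewrite /= powT gen_diagram_sym tensor_sym_diagram castD_sym_diagram.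
rewrite !imset0 setU0 imset0; eexists; split; first by [].
set E := esym _; have -> : setT = cast_ord E @: setT.
  apply/setP => i; rewrite inE; apply/esym/imsetP.
  by exists (cast_ord (esym E) i); rewrite ?cast_ordKV.
apply: (@interval_tiling_translate _ _ _ _ 0) => //; rewrite -lshift_rshift_setT.
apply: interval_tilingU; first exact: lshift_rshift_disjoint.
  exact: (@interval_tiling_translate _ _ _ _ 0).
apply: (@interval_tiling_translate _ _ _ _ (s * cA A)) => //.
exact: interval_tiling_setT (cA_gt0 A).
Qed.

Lemma tensor_idD_powD A k r s (hrs : r + s * cA A = k) :
  exists T, [/\ castD hrs (tensor (idD r) (powD (gen_diagram A) s)) =
                sym_diagram (head_points k r) T,
    interval_tiling (cA A) (~: head_points k r) T & #|T| = s].
Proof.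
set H := head_points k r; have [T [-> tilT]] := powD_interval_tiling A s.
rewrite idD_sym_diagram tensor_sym_diagram castD_sym_diagram !imset0 setU0 set0U.
have headE : cast_ord hrs @: (lshift (s * cA A) @: [set: 'I_r]) = H.
  apply/setP => i; rewrite inE -imset_comp; apply/imsetP/idP => [[j _ ->]|lt_ir] /=.
    exact: ltn_ord.
  by exists (Ordinal lt_ir); rewrite ?inE //; apply/val_inj.
have tailE : cast_ord hrs @: (@rshift r (s * cA A) @: setT) = ~: H.
  apply/setP => i; rewrite !inE -leqNgt -imset_comp.
  apply/imsetP/idP => [[j _ ->]|le_ri]; first exact: leq_addr.
  have lt_i : i - r < s * cA A by have := ltn_ord i; lia.
  by exists (Ordinal lt_i); rewrite ?inE //; apply/val_inj; rewrite /= subnKC.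
have tilH : interval_tiling (cA A) (~: H)
    [set cast_ord hrs @: (C : {set _}) |
      C in [set @rshift r _ @: (C : {set _}) | C in T]].
  rewrite -tailE; apply: (@interval_tiling_translate _ _ _ _ 0) => //.
  exact: (@interval_tiling_translate _ _ _ _ r).
eexists; split; [by rewrite headE | exact: tilH |].
case: tilH => partH intH; apply/eqP; rewrite -(eqn_pmul2r (cA_gt0 A)).
rewrite -(card_uniform_partition _ partH) => [|C /intH[]//].
rewrite -tailE !card_imset ?cardsT ?card_ord //; first exact: rshift_inj.
exact: cast_ord_inj.
Qed.

Lemma mate_noncrossing c k (S : {set 'I_k}) T : c <= 2 -> interval_tiling c S T ->
  noncrossing (mate T) set0.
Proof.
move=> le_c2 [partT intT]; apply/noncrossingP => a b /andP[lt_ab lt_ba].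
have aT : a \in cover T.
  by apply: contraTT lt_ba => /mate_id->; rewrite -leqNgt ltnW.
have le2T : {in T, forall C : {set 'I_k}, #|C| <= 2} by move=> C /intT[->].
have [_ /(_ a b (mate T a))] := intT _ (pblock_mem aT).
rewrite pblock_mate // set21 set22 lt_ab lt_ba => /(_ isT isT isT)/set2P[] eq_b.
  by rewrite eq_b ltnn in lt_ab.
by rewrite {1}eq_b ltnn in lt_ba.
Qed.

Lemma trD_interval_tiling (n : nat) A k r m T :
  r <= k -> interval_tiling (cA A) (~: head_points k r) T ->
  trD n A m (sym_diagram (head_points k r) T) =
  ((n%:R : rat) ^+ #|T| * (path_count A r m)%:R)%R.
Proof.
move=> le_rk tilT; have [partT intT] := tilT.
rewrite trD_sym_diagram //; congr (_ * _%:R)%R.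
have tT := partition_trivIset partT.
have le_cA2 : cA A <= 2 by case: (A).
have le2T : {in T, forall C : {set 'I_k}, #|C| <= 2} by move=> C /intT[->].
rewrite -(arcs_mate tT le2T partT) tailed_half_diagramsE => [|i le_ri].
  apply: card_tailed => // [||i lt_i]; first exact: mateK.
    exact: mate_noncrossing le_cA2 tilT.
  by rewrite mate_id // (cover_partition partT) !inE lt_i.
have iT : i \in cover T by rewrite (cover_partition partT) !inE -leqNgt.
have [+ _] := intT _ (pblock_mem iT); rewrite pblock_mate // cards2 eq_sym.
by case: (A) => /=; case: eqP.
Qed.

Theorem mainTheorem15 (A : Alg) (n k m r s : nat)
  (hn : 2 * k <= n) (hlam : inLambda A k m) (hrs : r + s * cA A = k) :
  chi n A m (castE hrs (tensorE (idE r) (powE (genE n A) s)))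
  = ((Fval A m r)%:~R : rat).
Proof.
have -> : genE n A = [:: ((n%:R : rat)^-1, gen_diagram A)]%R by case: (A).
rewrite powE_singleton /chi big_seq1 /= mul1r.
have [T [-> tilT cardT]] := tensor_idD_powD hrs.
have le_rk : r <= k by rewrite -hrs leq_addr.
rewrite trD_interval_tiling // cardT mulrA -exprMn.
have parity : A = TL -> odd m = odd r.
  move=> A_TL; case/andP: hlam => _; rewrite -hrs A_TL => /eqP->.
  by rewrite oddD oddM andbF addbF.
rewrite -(path_count_Fval parity) -pmulrn.
have [n0|n_gt0] := posnP n; last by rewrite mulVf ?expr1n ?mul1r // pnatr_eq0 -lt0n.
(* Here [n^-1 * n = 0], but the exponent is [0] too. *)
have -> : s = 0 by have := cA_gt0 A; nia.
by rewrite expr0 mul1r.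
Qed.
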